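(* Let $\hat{c}>0$ be a constant such that for all $n \ge 1$ every irreducible representation $\tau$ of $S_n$ has dimension $d_\tau \le e^{-(\hat{c}/2)\sqrt{n}}\sqrt{n!}$. Assume the following hypothesis holds: there is a constant $A$ such that, for all sufficiently large $n$, every irreducible representation $\lambda$ of $S_n$ with $d_\lambda > e^{-\sqrt{n}\log n}\sqrt{n!}$ satisfies $\left|\chi_\lambda(\pi)/d_\lambda\right| \le A^{t(\pi)} n^{-t(\pi)/2}$ for all $\pi \in S_n$. Then for any constants $b,c$ with $b < \hat{c}/2$ and $c < (\hat{c}/2) - b$, no sieve algorithm which combines fewer than $e^{b\sqrt{n}}$ coset states can solve Graph Isomorphism (via the hidden subgroup problem on $S_n \wr \mathbb{Z}_2$ described below) with success probability greater than $e^{-c\sqrt{n}}$.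
   Context: For $\pi \in S_n$, $t(\pi)$ is the minimum number of transpositions whose product is $\pi$; $\chi_\lambda$ and $d_\lambda$ denote the character and dimension of an irrep $\lambda$; $\log$ is the natural logarithm. Hidden subgroup setup: $S_n \wr \mathbb{Z}_2 = (S_n \times S_n)\rtimes \mathbb{Z}_2$, where the involution swaps the two factors; elements $((\alpha,\beta),1)$ are called flips. Graph Isomorphism of two rigid graphs on $n$ vertices reduces to the hidden subgroup problem on $G = S_n \wr \mathbb{Z}_2$ (acting on the $2n$ vertices of their disjoint union): the hidden subgroup $H$ is trivial if the graphs are nonisomorphic, and $H=\{1,m\}$ with $m=((\alpha,\alpha^{-1}),1)$ a flip if they are isomorphic. The coset state is $\rho_H = \frac{1}{|G|}\sum_{c} |cH\rangle\langle cH|$, where $|S\rangle = |S|^{-1/2}\sum_{g\in S}|g\rangle$. Sieve algorithm: (1) generate $\ell$ coset states and subject each to weak Fourier sampling, i.e. measure which maximal isotypic subspace (irrep name $\sigma$) of $\mathbb{C}[G]$ under the right regular representation the state lies in, recording the irrep name; (2) repeatedly, choose two current states according to an arbitrary adaptive rule depending on the entire history, and perform isotypic sampling on their tensor product with respect to the diagonal action of $G$ (projecting onto the maximal isotypic subspace of some irrep and recording its name); the two states are replaced by the resulting state; (3) based only on the record (transcript) of all observed irrep names and the combination structure, output a guess of whether $H$ is trivial or nontrivial. ''Combines fewer than $e^{b\sqrt n}$ coset states'' means $\ell < e^{b\sqrt{n}}$. The success probability refers to the algorithm's ability to distinguish the case $H$ trivial from the case $H=\{1,m\}$ (advantage over guessing),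 for all sufficiently large $n$.
   Formalization: The dimension bound defining ĉ is assumed for all n ≥ 2 instead of n ≥ 1, since at n = 1 it would read 1 ≤ e^{-ĉ/2}, which no ĉ > 0 satisfies. *)

(* Defs.v *)
From HB Require Import structures.
From mathcomp Require Import all_boot all_order all_algebra all_fingroup all_solvable.
From mathcomp Require Import all_field all_character.
From mathcomp Require Import all_classical all_reals all_analysis.

Set Implicit Arguments.
Unset Strict Implicit.
Unset Printing Implicit Defensive.

Import Order.TTheory GRing.Theory Num.Theory.
Local Open Scope ring_scope.

(* Real value of a (real) algebraic complex number, as an element of a       *)
(* realType R: the supremum of the rationals lying below it.  For real a     *)
(* (all uses below: degrees, absolute values) this is the usual value of a.   *)
Definition realC (R : realType) (a : algC) : R :=
  sup [set (ratr q : R) | q in [set q : rat | (ratr q : algC) < a]]%classic.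

Definition SymG (n : nat) : {group {perm 'I_n}} := [set: {perm 'I_n}]%G.

Definition is_tprod (n : nat) (s : {perm 'I_n}) (k : nat) : bool :=
  [exists ts : k.-tuple ('I_n * 'I_n),
     all perm.dpair ts && (s == (\prod_(t <- ts) tperm t.1 t.2)%g)].

Lemma tprod_exists (n : nat) (s : {perm 'I_n}) : exists k, is_tprod s k.
Proof.
case: (prod_tpermP s) => ts Hs Hd.
exists (size ts); apply/existsP; exists (in_tuple ts) => /=.
by rewrite Hd /= -Hs eqxx.
Qed.

Definition tcount (n : nat) (s : {perm 'I_n}) : nat := ex_minn (tprod_exists s).

(* S_n wr Z_2 realised as the permutations of the 2n vertices 'I_(n+n)       *)
(* (vertices < n: first graph, vertices >= n: second graph) that preserve    *)
(* the bipartition {first graph, second graph}.                             *)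
Definition lside (n : nat) (i : 'I_(n + n)) : bool := (i < n)%N.

Definition flip (n : nat) (p : {perm 'I_(n + n)}) : bool :=
  [forall i, lside (p i) == ~~ lside i].

Definition bip_preserving (n : nat) (p : {perm 'I_(n + n)}) : bool :=
  [forall i, lside (p i) == lside i] || flip p.

Definition Wr (n : nat) : {group {perm 'I_(n + n)}} :=
  <<[set p | bip_preserving p]>>%G.

(* Quantum states.  A "component" state lives on C[G]^{\otimes k}, with       *)
(* basis the k-tuples of group elements; it is given by its size k and its   *)
(* (possibly unnormalised) density matrix, indexed by sequences.             *)
Record cstate (gT : finGroupType) := CState {
  csize : nat;
  cmat : seq gT -> seq gT -> algC }.

Section Quantum.
Variable gT : finGroupType.

Definition cstate0 : cstate gT := CState 0 (fun _ _ => 0).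

Definition ctrace (s : cstate gT) : algC :=
  \sum_(x : (csize s).-tuple gT) cmat s x x.

Definition ctensor (s1 s2 : cstate gT) : cstate gT :=
  CState (csize s1 + csize s2)
    (fun x y => cmat s1 (take (csize s1) x) (take (csize s1) y)
              * cmat s2 (drop (csize s1) x) (drop (csize s1) y)).

(* diagonal right-regular action: R(g) |h_1..h_k> = |h_1 g^-1 .. h_k g^-1> *)
Definition rmul (g : gT) (x : seq gT) : seq gT := map (fun h => (h * g^-1)%g) x.

(* matrix of the isotypic projector P_i = (d_i/|G|) sum_g conj(chi_i g) R(g) *)
Definition isoproj (G : {group gT}) (i : Iirr G) (x y : seq gT) : algC :=
  'chi_i 1%g / #|G|%:R * \sum_(g in G) ('chi_i g)^* * (x == rmul g y)%:R.

(* unnormalised post-measurement state P_i rho P_i *)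
Definition isosample (G : {group gT}) (i : Iirr G) (s : cstate gT) : cstate gT :=
  CState (csize s) (fun x y =>
    \sum_(u : (csize s).-tuple gT) \sum_(v : (csize s).-tuple gT)
      isoproj i x u * cmat s u v * isoproj i v y).

(* coset state rho_H = 1/|G| sum_{c in G} |cH><cH|, |cH> = |H|^-1/2 sum_{h} |ch> *)
Definition coset_state (G H : {group gT}) : cstate gT :=
  CState 1 (fun x y => match x, y with
    | [:: a], [:: b] =>
        (#|G|%:R)^-1 * \sum_(c in G)
            (#|H|%:R)^-1 * ((a \in (c *: H)%g) && (b \in (c *: H)%g))%:R
    | _, _ => 0 end).

(* Sieve algorithms.  A transcript records the irrep names observed in the   *)
(* initial weak Fourier sampling and, for each combination step, the pair of *)
(* (current) indices combined together with the observed irrep name.         *)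
Definition transcript (G : {group gT}) :=
  (seq (Iirr G) * seq (nat * nat * Iirr G))%type.

Record sieve_alg (G : {group gT}) := SieveAlg {
  ell : nat;                                       (* number of coset states *)
  choose : transcript G -> option (nat * nat);     (* adaptive rule; None = stop *)
  guess : transcript G -> bool }.                  (* true = "H nontrivial" *)

Variable G : {group gT}.

(* joint probability weight of a product of unnormalised components *)
Definition weight (L : seq (cstate gT)) : algC := \prod_(s <- L) ctrace s.

Definition combine (L : seq (cstate gT)) (i j : nat) (sg : Iirr G) :=
  [seq nth cstate0 L k | k <- iota 0 (size L) & (k != i) && (k != j)]
  ++ [:: isosample sg (ctensor (nth cstate0 L i) (nth cstate0 L j))].

(* probability (summed over all branches) that the final guess is true *)
Fixpoint run (Alg : sieve_alg G) (fuel : nat) (L : seq (cstate gT))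
    (T : transcript G) : algC :=
  let stop := weight L * (guess Alg T)%:R in
  match fuel with
  | 0 => stop
  | f.+1 =>
    match choose Alg T with
    | Some (i, j) =>
        if [&& i != j, (i < size L)%N & (j < size L)%N] then
          \sum_(sg : Iirr G) run Alg f (combine L i j sg) (T.1, rcons T.2 (i, j, sg))
        else stop
    | None => stop
    end
  end.

Definition accept_prob (H : {group gT}) (Alg : sieve_alg G) : algC :=
  \sum_(t : (ell Alg).-tuple (Iirr G))
     run Alg (ell Alg) [seq isosample sg (coset_state G H) | sg <- t] (val t, [::]).

End Quantum.

(* Main.v *)
Require Import Defs.
From HB Require Import structures.
From mathcomp Require Import all_boot all_order all_algebra all_fingroup all_solvable.
From mathcomp Require Import all_field all_character.
From mathcomp Require Import all_classical all_reals all_analysis.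
From mathcomp Require Import ring lra zify.
Import Order.TTheory GRing.Theory Num.Theory.
Local Open Scope ring_scope.

Set Implicit Arguments.
Unset Strict Implicit.
Unset Printing Implicit Defensive.

(** A component [s] enters the sieve only through [state_char s g], the trace of
   [s] times the diagonal right translation by [g]: tensor products multiply
   these functions, isotypic sampling convolves them with an irreducible
   character, and the coset state of [H] gives the indicator of [H].

   Let [N = S_n x S_n] be the subgroup of non-flips.  Call an irreducible of
   [S_n wr Z_2] good if it is induced from [lambda x mu] with [lambda <> mu] both
   of large dimension; it vanishes off [N].  As long as all the outcomes are good,
   the values of [state_char] on [N] evolve independently of those on the flips,
   so a hidden flip leaves every transcript probability unchanged.  Hence the
   advantage is at most the probability of ever seeing a bad irreducible when [H]
   is trivial.

   In that case the first samples follow the Plancherel measure, which gives the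
   bad irreducibles weight [O(e^(- chat sqrt n))], by the dimension bound and by a
   bound [e^((1 + o(1)) sqrt n ln n)] on the number of classes of [S_n].  When two
   good irreducibles [i], [j] are combined, Cauchy-Schwarz bounds the probability
   of a bad outcome by the square root of that weight times
   [sum_g |chi_i(g) chi_j(g) / (d_i d_j)|^2]; by the character bound this sum is
   at most [(prod_(k < n) (1 + O(k / n^2)))^2 = O(1)].  A union bound over the
   fewer than [e^(b sqrt n)] steps concludes. *)

(** * Traces of quantum states *)

Definition state_char (gT : finGroupType) (s : cstate gT) (g : gT) : algC :=
  \sum_(x : (csize s).-tuple gT) cmat s x (rmul g x).

Lemma rmulM (gT : finGroupType) (g h : gT) (x : seq gT) :
  rmul g (rmul h x) = rmul (g * h)%g x.
Proof. by rewrite /rmul -map_comp; apply: eq_map => a /=; rewrite invMg mulgA. Qed.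

Lemma rmul1 (gT : finGroupType) (x : seq gT) : rmul 1%g x = x.
Proof. by rewrite /rmul -[RHS]map_id; apply: eq_map => a; rewrite invg1 mulg1. Qed.

Lemma state_char_trace (gT : finGroupType) (s : cstate gT) : ctrace s = state_char s 1%g.
Proof. by apply: eq_bigr => x _; rewrite rmul1. Qed.

Lemma cfun_mulC (gT : finGroupType) (G : {group gT}) (f : 'CF(G)) (x y : gT) :
  x \in G -> y \in G -> f (x * y)%g = f (y * x)%g.
Proof. by move=> Gx Gy; rewrite -(cfunJ f (y * x)%g Gy) conjgE mulgA mulKg. Qed.

(** The generalized orthogonality relation in convolution form: once scaled by [d_i / |G|], the
    irreducible characters are orthogonal idempotents. *)
Lemma irr_conv (gT : finGroupType) (G : {group gT}) (i j : Iirr G) (y : gT) :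
  \sum_(h in G) 'chi_i h * 'chi_j (h^-1 * y)%g
    = (i == j)%:R * #|G|%:R / 'chi_i 1%g * 'chi_i y.
Proof.
transitivity (\sum_(x in G) 'chi_j (x * y)%g * 'chi_i x^-1%g).
  rewrite (reindex_inj invg_inj) /=.
  by apply: eq_big => x; rewrite ?groupV // invgK mulrC.
rewrite -[LHS](mulVKf (neq0CG G)) generalized_orthogonality_relation eq_sym.
by have [->|_] := eqVneq i j; rewrite ?mul0r ?mulr0 // !mul1r -mulrA [_^-1 * _]mulrC.
Qed.

Lemma tuple_pick (gT : finGroupType) (k : nat) (y : k.-tuple gT) (F : seq gT -> algC) :
  \sum_(x : k.-tuple gT) (x == y :> seq gT)%:R * F x = F y.
Proof.
rewrite (bigD1 y) //= eqxx mul1r big1 ?addr0 // => x.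
by rewrite -val_eqE => /negPf /= ->; rewrite mul0r.
Qed.

Lemma rmul_eq_sum (gT : finGroupType) (k : nat) (g : gT) (y : k.-tuple gT)
    (F : seq gT -> algC) :
  \sum_(x : k.-tuple gT) (x == rmul g y :> seq gT)%:R * F x = F (rmul g y).
Proof. exact: (@tuple_pick gT k (map_tuple (fun h => h * g^-1)%g y)). Qed.

(** The left side is the [(v, u)] entry of [P_i R(g) P_i]. This equals [P_i R(g)], because [P_i] is
    idempotent and commutes with translations. *)
Lemma isoproj_comp (gT : finGroupType) (G : {group gT}) (i : Iirr G) (k : nat)
    (u v : k.-tuple gT) (g : gT) : g \in G ->
  \sum_(x : k.-tuple gT) isoproj i x u * isoproj i v (rmul g x)
  = 'chi_i 1%g / #|G|%:R *
    \sum_(h in G) ('chi_i (h * g^-1)%g)^* * (v == rmul h u :> seq gT)%:R.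
Proof.
move=> Gg; rewrite /isoproj; set c := _ / _.
under eq_bigr => x _ do rewrite mulrACA big_distrl /= mulr_sumr.
rewrite exchange_big /=.
transitivity (\sum_(h in G) \sum_(h' in G)
   c * c * (('chi_i h)^* * ('chi_i h')^* * (v == rmul (h' * g * h)%g u :> seq gT)%:R)).
  apply: eq_bigr => h Gh.
  pose F (x : seq gT) := c * c * (('chi_i h)^* *
    (\sum_(h' in G) ('chi_i h')^* * (v == rmul h' (rmul g x) :> seq gT)%:R)).
  transitivity (F (rmul h u)).
    by rewrite -rmul_eq_sum; apply: eq_bigr => x _; rewrite /F; ring.
  rewrite /F mulr_sumr mulr_sumr; apply: eq_bigr => h' _.
  by rewrite !rmulM; ring.
rewrite mulr_sumr.
(* The three translations compose to the one by [k0 = h' * g * h]. For fixed [k0] the sum over [h]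
   is a convolution of ['chi_i] with itself. *)
transitivity (\sum_(h in G) \sum_(k0 in G)
   c * c * (('chi_i h)^* * ('chi_i (h^-1 * (g^-1 * k0))%g)^* * (v == rmul k0 u :> seq gT)%:R)).
  apply: eq_bigr => h Gh.
  rewrite (reindex_inj (mulIg (h^-1 * g^-1)%g)) /=; apply: eq_big => k0.
    by rewrite groupMr // groupM ?groupV.
  rewrite groupMr ?groupM ?groupV // => Gk.
  rewrite (@cfun_mulC _ _ _ k0) ?groupM ?groupV // !mulgA.
  by rewrite (mulgKV g) (mulgKV h).
rewrite exchange_big /=; apply: eq_bigr => k0 Gk.
transitivity (c * c * (v == rmul k0 u :> seq gT)%:R * (\sum_(h in G) 'chi_i h * 'chi_i (h^-1 * (g^-1 * k0))%g)^*).
  by rewrite rmorph_sum mulr_sumr; apply: eq_bigr => h _; rewrite rmorphM /=; ring.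
rewrite irr_conv eqxx mul1r (@cfun_mulC _ _ _ k0) ?groupV //.
have C1 : ('chi_i 1%g)^* = 'chi_i 1%g by rewrite (conj_natr (Cnat_irr1 i)).
rewrite rmorphM fmorph_div /= C1 conjC_nat /c; field.
by rewrite irr1_neq0 neq0CG.
Qed.

(** Cyclicity of the trace: [Tr (P_i s P_i R(g)) = Tr (s P_i R(g) P_i)], where [isoproj_comp] leaves
    a single projector. *)
Lemma state_char_isosample (gT : finGroupType) (G : {group gT}) (i : Iirr G) (s : cstate gT)
    (g : gT) : g \in G ->
  state_char (isosample i s) g =
  'chi_i 1%g / #|G|%:R * \sum_(h in G) ('chi_i (h * g^-1)%g)^* * state_char s h.
Proof.
move=> Gg; rewrite /state_char /=; set c := _ / _.
rewrite exchange_big /=.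
transitivity (\sum_(u : (csize s).-tuple gT) \sum_(v : (csize s).-tuple gT)
   cmat s u v * (c * \sum_(h in G) ('chi_i (h * g^-1)%g)^* * (v == rmul h u :> seq gT)%:R)).
  apply: eq_bigr => u _; rewrite exchange_big /=; apply: eq_bigr => v _.
  rewrite -isoproj_comp // mulr_sumr; apply: eq_bigr => x _.
  by ring.
rewrite [RHS]mulr_sumr.
transitivity (\sum_(h in G) \sum_(u : (csize s).-tuple gT) c * (('chi_i (h * g^-1)%g)^* * cmat s u (rmul h u))).
  rewrite [RHS]exchange_big /=; apply: eq_bigr => u _.
  under eq_bigr => v _ do rewrite mulrCA mulr_sumr mulr_sumr.
  rewrite exchange_big /=; apply: eq_bigr => h _.
  rewrite -(rmul_eq_sum h u (fun v => c * (('chi_i (h * g^-1)%g)^* * cmat s u v))).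
  by apply: eq_bigr => v _; ring.
by apply: eq_bigr => h _; rewrite -!mulr_sumr.
Qed.

Lemma state_char_ctensor (gT : finGroupType) (s1 s2 : cstate gT) (g : gT) :
  state_char (ctensor s1 s2) g = state_char s1 g * state_char s2 g.
Proof.
case: s1 s2 => n1 f1 [n2 f2]; rewrite /state_char /= big_distrlr /= pair_big /=.
pose h (p : n1.-tuple gT * n2.-tuple gT) := [tuple of p.1 ++ p.2].
pose h' (x : (n1 + n2).-tuple gT) : n1.-tuple gT * n2.-tuple gT :=
  (tcast (minn_idPl (leq_addr n2 n1)) (take_tuple n1 x),
   tcast (addKn n1 n2) (drop_tuple n1 x)).
rewrite (reindex h) /=; last first.
  exists h' => [[a b] _ | x _].
    congr (_, _); apply: val_inj; rewrite /= val_tcast /=.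
      by rewrite take_size_cat ?size_tuple.
    by rewrite drop_size_cat ?size_tuple.
  by apply: val_inj; rewrite /= !val_tcast /= cat_take_drop.
apply: eq_bigr => -[a b] _ /=.
by rewrite /rmul map_cat !take_size_cat ?drop_size_cat ?size_map ?size_tuple.
Qed.

Lemma state_char_coset (gT : finGroupType) (G H : {group gT}) (g : gT) :
  state_char (coset_state G H) g = (g \in H)%:R.
Proof.
rewrite /state_char /=.
transitivity (\sum_(a : gT) cmat (coset_state G H) [:: a] [:: a * g^-1]%g).
  rewrite (reindex (fun a : gT => [tuple a])) //=.
  exists (fun t : 1.-tuple gT => thead t) => [//|t _].
  by apply: val_inj; case: t => -[|a [|b l]].
rewrite /= -mulr_sumr exchange_big /=.
(* Each coset contributes its overlap with its right translate by [g], which is the whole coset if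
   [g] lies in [H] and empty otherwise. *)
have E c : \sum_(a : gT) #|H|%:R^-1 * ((a \in (c *: H)%g) && (a * g^-1 \in c *: H)%g)%:R = (g \in H)%:R :> algC.
  rewrite -mulr_sumr; case Hg: (g \in H).
    rewrite -[RHS](@mulVf _ #|H|%:R) ?neq0CG //; congr (_ * _).
    rewrite -(card_lcoset H c) -sum1_card natr_sum [RHS]big_mkcond /=.
    apply: eq_bigr => a _.
    by rewrite !mem_lcoset mulgA (groupMr _ (groupVr Hg)); case: (_ \in _).
  rewrite big1 ?mulr0 // => a _; rewrite !mem_lcoset mulgA.
  case Ha: (_ \in H) => //=; rewrite groupMl // groupV Hg //.
under eq_bigr => c _ do rewrite E.
by rewrite sumr_const -[(g \in H)%:R *+ _]mulr_natl mulKf ?neq0CG.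
Qed.

(** * Positivity and total probability *)

(** Positivity is encoded as a nonnegative combination of rank-one forms, a shape that tensor
    products and conjugation by a Hermitian projector visibly preserve. *)
Definition psd (gT : finGroupType) (s : cstate gT) : Prop :=
  exists (I : finType) (c : I -> algC) (v : I -> seq gT -> algC),
    (forall i, 0 <= c i) /\
    (forall x y, cmat s x y = \sum_i c i * (v i x * (v i y)^*)).

Lemma psd_trace_ge0 (gT : finGroupType) (s : cstate gT) : psd s -> 0 <= ctrace s.
Proof.
case=> I [c [v [c0 Ev]]]; apply: sumr_ge0 => x _; rewrite Ev.
by apply: sumr_ge0 => i _; rewrite -normCK mulr_ge0 ?exprn_ge0.
Qed.

Lemma psd_ctensor (gT : finGroupType) (s1 s2 : cstate gT) :
  psd s1 -> psd s2 -> psd (ctensor s1 s2).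
Proof.
case=> I1 [c1 [v1 [p1 E1]]] [I2 [c2 [v2 [p2 E2]]]].
exists (I1 * I2)%type, (fun p => c1 p.1 * c2 p.2),
  (fun p x => v1 p.1 (take (csize s1) x) * v2 p.2 (drop (csize s1) x)).
split=> [p|x y]; first exact: mulr_ge0.
rewrite /= E1 E2 big_distrlr pair_big /=; apply: eq_bigr => -[i j] _ /=.
by rewrite rmorphM /=; ring.
Qed.

Lemma isoproj_conj (gT : finGroupType) (G : {group gT}) (i : Iirr G) (x y : seq gT) :
  (isoproj i x y)^* = isoproj i y x.
Proof.
rewrite /isoproj rmorphM rmorph_sum fmorph_div /= conjC_nat.
rewrite (conj_natr (Cnat_irr1 i)); congr (_ * _).
rewrite (reindex_inj invg_inj) /=; apply: eq_big => g; first by rewrite groupV.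
rewrite groupV => Gg; rewrite rmorphM /= conjC_nat conjCK irr_inv; congr (_ * _%:R).
congr nat_of_bool; apply/eqP/eqP => ->; rewrite rmulM ?mulgV ?mulVg rmul1 //.
Qed.

Lemma psd_isosample (gT : finGroupType) (G : {group gT}) (i : Iirr G) (s : cstate gT) :
  psd s -> psd (isosample i s).
Proof.
case=> I [c [v [c0 Ev]]]; exists I, c.
exists (fun j x => \sum_(u : (csize s).-tuple gT) isoproj i x u * v j u).
split=> // x y /=.
under eq_bigr => u _ do under eq_bigr => w _ do rewrite Ev mulr_sumr mulr_suml.
under eq_bigr => u _ do rewrite exchange_big /=.
rewrite exchange_big /=; apply: eq_bigr => j _.
rewrite rmorph_sum big_distrlr /= mulr_sumr; apply: eq_bigr => u _.
rewrite mulr_sumr; apply: eq_bigr => w _.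
by rewrite rmorphM /= isoproj_conj; ring.
Qed.

Lemma psd_coset (gT : finGroupType) (G H : {group gT}) : psd (coset_state G H).
Proof.
exists gT, (fun c => (c \in G)%:R * (#|G|%:R^-1 * #|H|%:R^-1)).
exists (fun c x => if x is [:: a] then (a \in (c *: H)%g)%:R else 0).
split=> [c|x y]; first by rewrite !mulr_ge0 ?invr_ge0 ?ler0n.
case: x => [|a [|? ?]]; rewrite /=; try by rewrite big1 // => c _; rewrite mul0r mulr0.
case: y => [|b [|? ?]]; rewrite /=; try by rewrite big1 // => c _; rewrite rmorph0 !mulr0.
rewrite mulr_sumr [LHS]big_mkcond /=; apply: eq_bigr => c _.
rewrite conjC_nat -mulnb natrM; case: (c \in G); by rewrite ?mul0r // mul1r !mulrA.
Qed.

(** The characters [d_i chi_i] sum to the regular character, which is supported at 1, so the outcome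
    probabilities add up to the trace. *)
Lemma sum_trace_isosample (gT : finGroupType) (G : {group gT}) (s : cstate gT) :
  \sum_(i : Iirr G) ctrace (isosample i s) = ctrace s.
Proof.
under eq_bigr => i _ do rewrite state_char_trace state_char_isosample // mulr_sumr.
rewrite exchange_big /=.
transitivity (\sum_(h in G) #|G|%:R^-1 * state_char s h * (cfReg G h)^*).
  apply: eq_bigr => h Gh; rewrite cfReg_sum sum_cfunE rmorph_sum mulr_sumr.
  apply: eq_bigr => i _; rewrite cfunE rmorphM /= (conj_natr (Cnat_irr1 i)).
  by rewrite invg1 mulg1; ring.
rewrite (bigD1 1%g) //= big1 => [|h /andP[_ nh]].
  by rewrite addr0 cfRegE eqxx conjC_nat mulrAC mulVf ?neq0CG // mul1r state_char_trace.
by rewrite cfRegE (negPf nh) conjC0 mulr0.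
Qed.

(** Convolving with [d_i / |G|] times ['chi_i] projects a class function onto its [i]-th irreducible
    component. *)
Lemma state_char_isosample_cfun (gT : finGroupType) (G : {group gT}) (i : Iirr G)
    (s : cstate gT) (phi : 'CF(G)) :
  {in G, state_char s =1 phi} ->
  {in G, state_char (isosample i s) =1 fun g => '[phi, 'chi_i] * 'chi_i g}.
Proof.
move=> Es g Gg; rewrite state_char_isosample //.
transitivity ('chi_i 1%g / #|G|%:R * \sum_(j : Iirr G) '[phi, 'chi_j] *
   (\sum_(h in G) 'chi_j h * 'chi_i (h^-1 * g)%g)).
  congr (_ * _); under [RHS]eq_bigr => j _ do rewrite mulr_sumr.
  rewrite exchange_big /=; apply: eq_bigr => h Gh.
  rewrite Es // {1}[phi]cfun_sum_cfdot sum_cfunE mulr_sumr; apply: eq_bigr => j _.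
  rewrite cfunE -irr_inv invMg invgK cfun_mulC ?groupV //; ring.
rewrite (bigD1 i) //= irr_conv eqxx big1 ?addr0 => [|j nij].
  by rewrite mulr1n; field; rewrite neq0CG irr1_neq0.
by rewrite irr_conv (negPf nij) !mul0r mulr0.
Qed.

(** At [g = 1] this is the Plancherel probability [d_i ^ 2 / |G|]. *)
Lemma state_char_isosample_coset1 (gT : finGroupType) (G : {group gT}) (i : Iirr G) :
  {in G, state_char (isosample i (coset_state G 1%G)) =1
         fun g => 'chi_i 1%g / #|G|%:R * 'chi_i g}.
Proof.
move=> g Gg; rewrite state_char_isosample //; congr (_ * _).
rewrite (bigD1 1%g) //= big1 => [|h /andP[_ nh]].
  by rewrite state_char_coset inE eqxx mulr1 mul1g addr0 irr_inv conjCK.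
by rewrite state_char_coset inE (negPf nh) mulr0.
Qed.

(** For [g] in [N], [h * g^-1] lies in [N] exactly when [h] does, so the convolution with ['chi_i]
    reads the state only on [N]. This is what keeps a hidden flip invisible after a good outcome. *)
Lemma state_char_isosample_sub (gT : finGroupType) (G N : {group gT}) (i : Iirr G)
    (s s' : cstate gT) :
  N \subset G -> (forall g, g \notin N -> 'chi_i g = 0) ->
  {in N, state_char s =1 state_char s'} -> {in N, state_char (isosample i s) =1 state_char (isosample i s')}.
Proof.
move=> sNG chi0 Es g Ng; have Gg := fintype.subsetP sNG g Ng.
rewrite !state_char_isosample //; congr (_ * _); apply: eq_bigr => h Gh.
have [Nh|nNh] := boolP (h \in N); first by rewrite Es.
by rewrite chi0 ?rmorph0 ?mul0r // groupMr ?groupV.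
Qed.

(** One step of comparing two processes: [w], [w'] are the branch probabilities and [r], [r'] the
    accepting parts. Good branches differ by at most [d] times their weight, while the bad branches
    together cost at most their total weight. *)
Lemma sum_split_bound (I : finType) (good : pred I) (r r' w w' : I -> algC)
    (W d e : algC) :
  (forall i, 0 <= r i <= w i) -> (forall i, 0 <= r' i <= w' i) ->
  \sum_i w i = W -> \sum_i w' i = W -> (forall i, good i -> w i = w' i) ->
  (forall i, good i -> `|r' i - r i| <= d * w i) ->
  \sum_(i | ~~ good i) w i <= e * W -> 0 <= d ->
  `|\sum_i r' i - \sum_i r i| <= (d + e) * W.
Proof.
move=> br br' sw sw' gw gr bw d0.
have w0 i : 0 <= w i by case/andP: (br i); apply: le_trans.
rewrite (bigID good) [X in _ - X](bigID good) /= opprD addrACA.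
rewrite mulrDl; apply: le_trans (ler_normD _ _) _.
(* The totals agree and the good weights agree, hence so do the bad totals; only [w] needs a bound
   on its bad part. *)
have Eb : \sum_(i | ~~ good i) w' i = \sum_(i | ~~ good i) w i.
  move: sw' sw; rewrite (bigID good) (bigID good _ w) /= (eq_bigr _ gw) => <-.
  by move/addrI => ->.
have bnd (f g : I -> algC) : (forall i, 0 <= f i <= g i) ->
    0 <= \sum_(i | ~~ good i) f i <= \sum_(i | ~~ good i) g i.
  move=> fg; rewrite sumr_ge0 ?ler_sum // => i _; by case/andP: (fg i).
apply: lerD.
  rewrite -sumrB; apply: le_trans (ler_norm_sum _ _ _) _.
  apply: (@le_trans _ _ (\sum_(i | good i) d * w i)); first exact: ler_sum.
  rewrite -mulr_sumr ler_wpM2l // -sw [leRHS](bigID good) /= lerDl.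
  exact: sumr_ge0.
apply: le_trans bw.
have := bnd _ _ br; have := bnd _ _ br'; rewrite Eb.
set x := \sum_(i | _) r' i; set y := \sum_(i | _) r i; set z := \sum_(i | _) w i.
move=> /andP[x0 xz] /andP[y0 yz].
rewrite real_ler_norml ?rpredB ?ger0_real //.
apply/andP; split; last by rewrite lerBlDr (le_trans xz) ?lerDl.
by rewrite lerBrDr addrC (le_trans _ x0) // subr_le0.
Qed.

(** * Independent draws and the union bound *)

Lemma sum_tuple_prod (I : finType) (n : nat) (p : I -> algC) :
  \sum_(t : n.-tuple I) \prod_(x <- t) p x = (\sum_x p x) ^+ n.
Proof.
rewrite -[n in RHS]card_ord -prodr_const bigA_distr_bigA /=.
rewrite (reindex (fun f : {ffun 'I_n -> I} => [tuple f i | i < n])) /=.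
  by apply: eq_bigr => f _; rewrite big_map big_enum.
exists (fun t => [ffun i => tnth t i]) => [f _|t _].
  by apply/ffunP => i; rewrite ffunE tnth_mktuple.
by apply: eq_from_tnth => i; rewrite tnth_mktuple ffunE.
Qed.

Lemma one_sub_expr_le (n : nat) (q : algC) :
  0 <= q <= 1 -> 1 - (1 - q) ^+ n <= n%:R * q.
Proof.
case/andP=> q0 q1; have p0 : 0 <= 1 - q by rewrite subr_ge0.
have p1 : 1 - q <= 1 by rewrite lerBlDr lerDl.
elim: n => [|n IH]; first by rewrite expr0 subrr mul0r.
have -> : 1 - (1 - q) ^+ n.+1 = (1 - (1 - q) ^+ n) + q * (1 - q) ^+ n by rewrite exprS; ring.
rewrite -natr1 mulrDl mul1r lerD // ler_piMr // exprn_ile1 //.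
Qed.

(** With [q] the probability of a bad draw, [n] independent draws contain a bad one with probability
    [1 - (1 - q) ^+ n], at most [n * q] by Bernoulli's inequality. *)
Lemma sum_tuple_bad (I : finType) (n : nat) (p : I -> algC) (good : pred I) :
  (forall x, 0 <= p x) -> \sum_x p x = 1 ->
  \sum_(t : n.-tuple I | ~~ all good t) \prod_(x <- t) p x
    <= n%:R * \sum_(x | ~~ good x) p x.
Proof.
move=> p0 p1.
have q0 : 0 <= \sum_(x | ~~ good x) p x by apply: sumr_ge0.
have Eq : \sum_(x | good x) p x = 1 - \sum_(x | ~~ good x) p x.
  by rewrite -p1 [in RHS](bigID good) /= addrK.
have q1 : \sum_(x | ~~ good x) p x <= 1.
  by rewrite -subr_ge0 -Eq sumr_ge0.
apply: le_trans (one_sub_expr_le n _); last by rewrite q0.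
rewrite -Eq [X in _ <= X - _](_ : 1 = \sum_(t : n.-tuple I) \prod_(x <- t) p x); last first.
  by rewrite sum_tuple_prod p1 expr1n.
rewrite [X in _ <= X - _](bigID (fun t : n.-tuple I => all good t)) /=.
rewrite [X in _ <= X + _ - _](_ : _ = (\sum_(x | good x) p x) ^+ n).
  by rewrite addrC addKr.
rewrite [in RHS]big_mkcond -sum_tuple_prod big_mkcond; apply: eq_bigr => t _.
elim: (val t) => [|a s IH] /=; first by rewrite !big_nil.
rewrite !big_cons -IH; case: (good a) => /=; last by rewrite mul0r.
by case: (all good s); rewrite ?mulr0.
Qed.

(** * The sieve process *)

Definition rest_weight (gT : finGroupType) (L : seq (cstate gT)) (i j : nat) : algC :=
  \prod_(k <- iota 0 (size L) | (k != i) && (k != j)) ctrace (nth (cstate0 gT) L k).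

Lemma weight_split (gT : finGroupType) (L : seq (cstate gT)) (i j : nat) :
  i != j -> (i < size L)%N -> (j < size L)%N ->
  weight L = rest_weight L i j *
    ctrace (ctensor (nth (cstate0 gT) L i) (nth (cstate0 gT) L j)).
Proof.
move=> nij ilt jlt; rewrite /weight (big_nth (cstate0 gT)).
rewrite [index_iota _ _]/index_iota subn0.
rewrite (bigD1_seq i) ?mem_iota ?iota_uniq //= big_mkcond /=.
rewrite (bigD1_seq j) ?mem_iota ?iota_uniq //= eq_sym nij mulrA mulrC.
rewrite !state_char_trace state_char_ctensor; congr (_ * _).
rewrite /rest_weight big_mkcond [RHS]big_mkcond /=; apply: eq_bigr => k _.
by case: (k == i); case: (k == j).
Qed.

Lemma weight_combine (gT : finGroupType) (G : {group gT}) (L : seq (cstate gT))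
    (i j : nat) (sg : Iirr G) :
  weight (combine L i j sg) = rest_weight L i j *
    ctrace (isosample sg (ctensor (nth (cstate0 gT) L i) (nth (cstate0 gT) L j))).
Proof. by rewrite /weight /combine big_cat big_seq1 big_map big_filter. Qed.

Lemma sum_weight_combine (gT : finGroupType) (G : {group gT}) (L : seq (cstate gT))
    (i j : nat) : i != j -> (i < size L)%N -> (j < size L)%N ->
  \sum_(sg : Iirr G) weight (combine L i j sg) = weight L.
Proof.
move=> nij ilt jlt; under eq_bigr => sg _ do rewrite weight_combine.
by rewrite -mulr_sumr sum_trace_isosample -weight_split.
Qed.

(** A Boolean form of [psd], so that [all] can state it of a list of components. *)
Definition apsd (gT : finGroupType) (s : cstate gT) : bool := `[< psd s >].

Lemma psd_nth (gT : finGroupType) (L : seq (cstate gT)) (k : nat) :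
  all (@apsd gT) L -> (k < size L)%N -> psd (nth (cstate0 gT) L k).
Proof. by move=> /(all_nthP (cstate0 gT)) aL /aL /asboolP. Qed.

Lemma weight_ge0 (gT : finGroupType) (L : seq (cstate gT)) :
  all (@apsd gT) L -> 0 <= weight L.
Proof.
elim: L => [|s L IH] /=; first by rewrite /weight big_nil.
case/andP=> /asboolP ps /IH; rewrite /weight big_cons => w0.
by rewrite mulr_ge0 // psd_trace_ge0.
Qed.

Lemma apsd_combine (gT : finGroupType) (G : {group gT}) (L : seq (cstate gT))
    (i j : nat) (sg : Iirr G) : (i < size L)%N -> (j < size L)%N ->
  all (@apsd gT) L -> all (@apsd gT) (combine L i j sg).
Proof.
move=> ilt jlt aL; rewrite all_cat /= andbT; apply/andP; split; last first.
  by apply/asboolP/psd_isosample/psd_ctensor; apply: psd_nth.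
rewrite all_map; apply/allP => k; rewrite mem_filter mem_iota add0n => /andP[_ /= klt].
exact/asboolP/psd_nth.
Qed.

Lemma run_bounds (gT : finGroupType) (G : {group gT}) (Alg : sieve_alg G) (f : nat)
    (L : seq (cstate gT)) (T : transcript G) :
  all (@apsd gT) L -> 0 <= run Alg f L T <= weight L.
Proof.
have stop (L' : seq (cstate gT)) T' : all (@apsd gT) L' ->
    0 <= weight L' * (guess Alg T')%:R <= weight L'.
  move=> /weight_ge0 w0; case: (guess _ _); rewrite ?mulr1 ?mulr0 ?w0 ?lexx //.
elim: f L T => [|f IH] L T aL /=; first exact: stop.
case: (Defs.choose Alg T) => [[i j]|]; last exact: stop.
case: ifP => [/and3P[nij ilt jlt]|_]; last exact: stop.
rewrite -(sum_weight_combine G nij ilt jlt).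
have b sg := IH _ (T.1, rcons T.2 (i, j, sg)) (apsd_combine sg ilt jlt aL).
by rewrite sumr_ge0 ?ler_sum // => sg _; case/andP: (b sg).
Qed.

(* The first component is the state evolved from the trivial subgroup, the second
   one the state with the same transcript evolved from the hidden subgroup. *)
Definition twin (gT : finGroupType) (G N : {group gT}) (good : pred (Iirr G))
    (p : cstate gT * cstate gT) : Prop :=
  [/\ psd p.1, psd p.2, {in N, state_char p.1 =1 state_char p.2} &
      exists i c, [/\ good i, 0 <= c & {in G, state_char p.1 =1 fun g => c * 'chi_i g}]].

(** The two processes advance in lockstep along the same transcript; the projections of this list
    are the two ordinary combination steps. *)
Definition combine2 (gT : finGroupType) (G : {group gT})
    (LL : seq (cstate gT * cstate gT)) (i j : nat) (sg : Iirr G) :=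
  let d := (cstate0 gT, cstate0 gT) in
  [seq nth d LL k | k <- iota 0 (size LL) & (k != i) && (k != j)]
  ++ [:: (isosample sg (ctensor (nth d LL i).1 (nth d LL j).1),
          isosample sg (ctensor (nth d LL i).2 (nth d LL j).2))].

Lemma map_combine2 (gT : finGroupType) (G : {group gT})
    (LL : seq (cstate gT * cstate gT)) (i j : nat) (sg : Iirr G) :
  (i < size LL)%N -> (j < size LL)%N ->
  [seq p.1 | p <- combine2 LL i j sg] = combine [seq p.1 | p <- LL] i j sg /\
  [seq p.2 | p <- combine2 LL i j sg] = combine [seq p.2 | p <- LL] i j sg.
Proof.
move=> ilt jlt; rewrite /combine2 /combine !map_cat /= !size_map -!map_comp.
pose d := (cstate0 gT, cstate0 gT).
split; rewrite !(nth_map d) //; congr (_ ++ _); apply/eq_in_map => k;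
  by rewrite mem_filter mem_iota add0n => /andP[_ /= klt]; rewrite (nth_map d).
Qed.

(** On [G] the tensor product of the first components is a nonnegative multiple of
    ['chi_a * 'chi_b]; sampling [sg] turns it into a multiple of ['chi_sg], nonnegative because
    multiplicities are. *)
Lemma twin_combine2 (gT : finGroupType) (G N : {group gT}) (good : pred (Iirr G))
    (LL : seq (cstate gT * cstate gT)) (i j : nat) (sg : Iirr G) :
  N \subset G -> (forall i, good i -> forall g, g \notin N -> 'chi_i g = 0) ->
  (i < size LL)%N -> (j < size LL)%N -> good sg ->
  all (fun p => `[< twin N good p >]) LL ->
  all (fun p => `[< twin N good p >]) (combine2 LL i j sg).
Proof.
move=> sNG chi0 ilt jlt gsg /(all_nthP (cstate0 gT, cstate0 gT)) aL.
rewrite all_cat /= andbT; apply/andP; split.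
  rewrite all_map; apply/allP => k; rewrite mem_filter mem_iota add0n => /andP[_ /= klt].
  exact: aL.
apply/asboolP.
have /asboolP[pi1 pi2 ei [a [c [ga c0 ec]]]] := aL i ilt.
have /asboolP[pj1 pj2 ej [b [c' [gb c'0 ec']]]] := aL j jlt.
split=> /=; try exact/psd_isosample/psd_ctensor.
  apply: state_char_isosample_sub => //; first exact: chi0.
  by move=> g Ng; rewrite !state_char_ctensor ei // ej.
have E : {in G, state_char (ctensor (nth (cstate0 gT, cstate0 gT) LL i).1
    (nth (cstate0 gT, cstate0 gT) LL j).1) =1 ((c * c') *: ('chi_a * 'chi_b))}.
  by move=> g Gg; rewrite state_char_ctensor ec // ec' // !cfunE; ring.
exists sg, '[(c * c') *: ('chi_a * 'chi_b), 'chi_sg]; split=> //.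
  rewrite cfdotZl; apply: mulr_ge0; first exact: mulr_ge0.
  by apply: natr_ge0; rewrite Cnat_cfdot_char ?rpredM ?irr_char.
exact: state_char_isosample_cfun.
Qed.

(** Combining states of types [a] and [b] gives outcome [sg] with conditional probability
    ['['chi_a * 'chi_b, 'chi_sg] * d_sg / (d_a * d_b)]. The other components only contribute a
    common factor. *)
Lemma twin_bad_weight (gT : finGroupType) (G N : {group gT}) (good : pred (Iirr G))
    (LL : seq (cstate gT * cstate gT)) (i j : nat) (eps : algC) :
  (forall i j, good i -> good j ->
    \sum_(k | ~~ good k) '['chi[G]_i * 'chi_j, 'chi_k] * 'chi_k 1%g
      <= eps * ('chi_i 1%g * 'chi_j 1%g)) ->
  i != j -> (i < size LL)%N -> (j < size LL)%N ->
  all (fun p => `[< twin N good p >]) LL ->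
  \sum_(sg | ~~ good sg) weight (combine [seq p.1 | p <- LL] i j sg)
     <= eps * weight [seq p.1 | p <- LL].
Proof.
move=> heps nij ilt jlt /(all_nthP (cstate0 gT, cstate0 gT)) aL.
rewrite (@weight_split _ _ i j) ?size_map //.
under eq_bigr => sg _ do rewrite weight_combine.
rewrite -mulr_sumr mulrCA; apply: ler_wpM2l.
  rewrite /rest_weight big_seq_cond; apply: prodr_ge0 => k.
  rewrite size_map mem_iota add0n => /andP[/= klt _].
  rewrite (nth_map (cstate0 gT, cstate0 gT)) //.
  by apply: psd_trace_ge0; have /asboolP[] := aL k klt.
rewrite !(nth_map (cstate0 gT, cstate0 gT)) //.
have /asboolP[pi1 pi2 ei [a [c [ga c0 ec]]]] := aL i ilt.
have /asboolP[pj1 pj2 ej [b [c' [gb c'0 ec']]]] := aL j jlt.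
have E : {in G, state_char (ctensor (nth (cstate0 gT, cstate0 gT) LL i).1
    (nth (cstate0 gT, cstate0 gT) LL j).1) =1 ((c * c') *: ('chi_a * 'chi_b))}.
  by move=> g Gg; rewrite state_char_ctensor ec // ec' // !cfunE; ring.
rewrite state_char_trace E // !cfunE.
under eq_bigr => sg _ do rewrite state_char_trace (state_char_isosample_cfun _ E) // cfdotZl -mulrA.
by rewrite -mulr_sumr mulrCA ler_wpM2l ?mulr_ge0 ?heps.
Qed.

(** Each unit of fuel loses at most a fraction [eps] of the weight to bad outcomes. When the run
    stops, twin states have equal weights and the guess reads only the transcript, so nothing more
    is lost. *)
Lemma run_diff (gT : finGroupType) (G N : {group gT}) (good : pred (Iirr G))
    (eps : algC) (Alg : sieve_alg G) (f : nat)
    (LL : seq (cstate gT * cstate gT)) (T : transcript G) :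
  N \subset G -> (forall i, good i -> forall g, g \notin N -> 'chi_i g = 0) ->
  (forall i j, good i -> good j ->
    \sum_(k | ~~ good k) '['chi[G]_i * 'chi_j, 'chi_k] * 'chi_k 1%g
      <= eps * ('chi_i 1%g * 'chi_j 1%g)) ->
  0 <= eps -> all (fun p => `[< twin N good p >]) LL ->
  `|run Alg f [seq p.2 | p <- LL] T - run Alg f [seq p.1 | p <- LL] T|
     <= f%:R * eps * weight [seq p.1 | p <- LL].
Proof.
move=> sNG chi0 heps eps0.
have aP1 LL' : all (fun p => `[< twin N good p >]) LL' -> all (@apsd gT) [seq p.1 | p <- LL'].
  by rewrite all_map; apply: sub_all => p /asboolP[p1 _ _ _]; apply/asboolP.
have aP2 LL' : all (fun p => `[< twin N good p >]) LL' -> all (@apsd gT) [seq p.2 | p <- LL'].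
  by rewrite all_map; apply: sub_all => p /asboolP[_ p2 _ _]; apply/asboolP.
have eqw LL' : all (fun p => `[< twin N good p >]) LL' ->
    weight [seq p.2 | p <- LL'] = weight [seq p.1 | p <- LL'].
  rewrite /weight !big_map => aL; elim: LL' aL => [|p LL' IH] /=; first by rewrite !big_nil.
  case/andP=> /asboolP[_ _ e _] /IH; rewrite !big_cons => ->.
  by rewrite !state_char_trace e.
elim: f LL T => [|f IH] LL T aL /=.
  by rewrite eqw // subrr normr0 !mul0r.
have w0 : 0 <= weight [seq p.1 | p <- LL] by apply/weight_ge0/aP1.
have stop b : `|weight [seq p.2 | p <- LL] * b - weight [seq p.1 | p <- LL] * b|
    <= f.+1%:R * eps * weight [seq p.1 | p <- LL].
  by rewrite eqw // subrr normr0 !mulr_ge0.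
case: (Defs.choose Alg T) => [[i j]|]; last exact: stop.
rewrite !size_map; case: ifP => [/and3P[nij ilt jlt]|_]; last exact: stop.
rewrite -[f.+1%:R]natr1 mulrDl mul1r.
have b1 sg := run_bounds Alg f (T.1, rcons T.2 (i, j, sg))
  (apsd_combine sg (etrans (congr1 _ (size_map _ _)) ilt) (etrans (congr1 _ (size_map _ _)) jlt) (aP1 _ aL)).
have b2 sg := run_bounds Alg f (T.1, rcons T.2 (i, j, sg))
  (apsd_combine sg (etrans (congr1 _ (size_map _ _)) ilt) (etrans (congr1 _ (size_map _ _)) jlt) (aP2 _ aL)).
apply: (sum_split_bound (good := good) b1 b2).
- by rewrite sum_weight_combine ?size_map.
- by rewrite sum_weight_combine ?size_map // eqw.
- move=> sg gsg; have [<- <-] := map_combine2 sg ilt jlt.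
  by rewrite eqw //; apply: twin_combine2.
- move=> sg gsg; have [<- <-] := map_combine2 sg ilt jlt.
  by apply: IH; apply: twin_combine2.
- exact: twin_bad_weight heps nij ilt jlt aL.
- exact: mulr_ge0.
Qed.

(** The [ell] initial samples are all good except with probability at most [ell * eps0]; [run_diff]
    with fuel [ell] then adds at most [ell * eps]. *)
Lemma accept_diff (gT : finGroupType) (G N H : {group gT}) (good : pred (Iirr G))
    (eps eps0 : algC) (Alg : sieve_alg G) :
  N \subset G -> (forall g, g \in N -> g \in H -> g = 1%g) ->
  (forall i, good i -> forall g, g \notin N -> 'chi_i g = 0) ->
  (forall i j, good i -> good j ->
    \sum_(k | ~~ good k) '['chi[G]_i * 'chi_j, 'chi_k] * 'chi_k 1%g
      <= eps * ('chi_i 1%g * 'chi_j 1%g)) ->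
  0 <= eps -> \sum_(k | ~~ good k) 'chi[G]_k 1%g ^+ 2 / #|G|%:R <= eps0 ->
  `|accept_prob H Alg - accept_prob 1%G Alg| <= (ell Alg)%:R * (eps + eps0).
Proof.
move=> sNG tiNH chi0 heps eps_ge0 heps0; rewrite /accept_prob mulrDr.
set l := ell Alg.
pose st (K : {group gT}) (t : seq (Iirr G)) :=
  [seq isosample sg (coset_state G K) | sg <- t].
have aps K t : all (@apsd gT) (st K t).
  by rewrite all_map; apply/allP => sg _; apply/asboolP/psd_isosample/psd_coset.
have b K (t : l.-tuple (Iirr G)) := run_bounds Alg l (val t, [::]) (aps K (val t)).
have tot K : \sum_(t : l.-tuple (Iirr G)) weight (st K t) = 1.
  under eq_bigr => t _ do rewrite /weight big_map.
  rewrite (sum_tuple_prod _ (fun sg => ctrace (isosample sg (coset_state G K)))).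
  by rewrite sum_trace_isosample state_char_trace state_char_coset group1 expr1n.
pose LL (t : seq (Iirr G)) :=
  [seq (isosample sg (coset_state G 1%G), isosample sg (coset_state G H)) | sg <- t].
have L1 t : [seq p.1 | p <- LL t] = st 1%G t by rewrite -map_comp.
have L2 t : [seq p.2 | p <- LL t] = st H t by rewrite -map_comp.
have tw (t : seq (Iirr G)) : all good t -> all (fun p => `[< twin N good p >]) (LL t).
  move=> gt; rewrite all_map; apply/allP => sg /(allP gt) gsg; apply/asboolP.
  split=> /=; try exact/psd_isosample/psd_coset.
    apply: state_char_isosample_sub => //; first exact: chi0.
    (* Since [N] meets [H] trivially, the indicators of [H] and of the trivial subgroup coincide on
       [N]. *)
    move=> g Ng; rewrite !state_char_coset inE; congr _%:R; congr nat_of_bool.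
    by apply/eqP/idP => [->|/(tiNH g Ng)].
  exists sg, ('chi_sg 1%g / #|G|%:R); split=> //.
    by rewrite divr_ge0 ?ler0n // ltW // irr1_gt0.
  exact: state_char_isosample_coset1.
rewrite -[leRHS]mulr1.
apply: (sum_split_bound (good := fun t : l.-tuple (Iirr G) => all good t) (b _) (b _)) => //.
- move=> t gt; rewrite /weight /st !big_map.
  have {}gt : all good (val t) := gt.
  elim: (val t) gt => [|sg s IH] /=; first by rewrite !big_nil.
  rewrite !big_cons => /andP[gsg /IH ->].
  congr (_ * _); rewrite !state_char_trace.
  have /andP[/asboolP[_ _ e _] _] := tw [:: sg] (introT andP (conj gsg isT)).
  by rewrite -e.
- move=> t gt; rewrite -L1 -L2.
  exact: (run_diff Alg l (val t, [::]) sNG chi0 heps eps_ge0 (tw _ gt)).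
- rewrite mulr1; under eq_bigr => t _ do rewrite /weight big_map.
  have P sg : ctrace (isosample sg (coset_state G 1%G)) = 'chi[G]_sg 1%g ^+ 2 / #|G|%:R.
    by rewrite state_char_trace state_char_isosample_coset1 //; ring.
  under eq_bigr => t _ do under eq_bigr => sg _ do rewrite P.
  apply: le_trans (ler_wpM2l (ler0n _ _) heps0).
  apply: sum_tuple_bad => [sg|]; first by rewrite divr_ge0 ?ler0n // exprn_ge0 // ltW // irr1_gt0.
  by rewrite -mulr_suml irr_sum_square divff // neq0CG.
- exact: mulr_ge0.
Qed.

(** Cauchy-Schwarz applied to ['chi_i * 'chi_j] and the bad part [psi] of the regular character,
    whose squared norm is [|G|] times the bad Plancherel weight. *)
Lemma bad_product_weight (gT : finGroupType) (G : {group gT}) (good : pred (Iirr G))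
    (C eps0 : algC) (i j : Iirr G) :
  \sum_(k | ~~ good k) 'chi[G]_k 1%g ^+ 2 / #|G|%:R <= eps0 -> 0 <= C ->
  \sum_(g in G) `|'chi_i g * 'chi_j g| ^+ 2 <= C * ('chi_i 1%g * 'chi_j 1%g) ^+ 2 ->
  (\sum_(k | ~~ good k) '['chi[G]_i * 'chi_j, 'chi_k] * 'chi_k 1%g) ^+ 2
    <= C * eps0 * ('chi_i 1%g * 'chi_j 1%g) ^+ 2.
Proof.
move=> h0 C0 hC; set psi := \sum_(k | ~~ good k) 'chi[G]_k 1%g *: 'chi_k.
have -> : \sum_(k | ~~ good k) '['chi[G]_i * 'chi_j, 'chi_k] * 'chi_k 1%g
    = '['chi_i * 'chi_j, psi].
  rewrite cfdot_sumr; apply: eq_bigr => k _.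
  by rewrite cfdotZr (conj_natr (Cnat_irr1 k)) mulrC.
have r0 : 0 <= '['chi_i * 'chi_j, psi].
  apply: natr_ge0; apply: Cnat_cfdot_char; first by rewrite rpredM ?irr_char.
  apply: rpred_sum => k _; by rewrite rpredZ_nat ?Cnat_irr1 ?irr_char.
rewrite -[X in X ^+ 2](ger0_norm r0).
apply: le_trans (cfCauchySchwarz _ _).1 _.
have -> : '[psi] = \sum_(k | ~~ good k) 'chi[G]_k 1%g ^+ 2.
  rewrite cfdot_sum_irr big_mkcond [RHS]big_mkcond; apply: eq_bigr => k _.
  have -> : '[psi, 'chi_k] = if ~~ good k then 'chi_k 1%g else 0.
    rewrite cfdot_suml; case: ifP => gk; last first.
      rewrite big1 // => a ga; rewrite cfdotZl cfdot_irr; case: eqVneq => [ak|_]; last by rewrite mulr0.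
      by rewrite ak gk in ga.
    rewrite (bigD1 k) //= cfdotZl cfnorm_irr mulr1 big1 ?addr0 // => a /andP[_ nak].
    by rewrite cfdotZl cfdot_irr (negPf nak) mulr0.
  by case: (good k) => /=; rewrite ?mul0r // (conj_natr (Cnat_irr1 k)) expr2.
rewrite (cfnormE (cfun_onG _)).
have -> : \sum_(g in G) `|('chi_i * 'chi_j)%CF g| ^+ 2
    = \sum_(g in G) `|'chi_i g * 'chi_j g| ^+ 2.
  by apply: eq_bigr => g _; rewrite cfunE.
move: h0; rewrite -mulr_suml => h0; rewrite mulrAC mulrC [#|G|%:R^-1 * _]mulrC.
rewrite [leRHS](_ : _ = C * ('chi_i 1%g * 'chi_j 1%g) ^+ 2 * eps0); last by ring.
apply: ler_pM => //; first by apply: sumr_ge0 => g _; rewrite exprn_ge0.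
by rewrite divr_ge0 ?ler0n // sumr_ge0 // => k _; rewrite exprn_ge0 // ltW // irr1_gt0.
Qed.

(** * Cycles of permutations *)

Lemma porbits_tperm_mul_ge (T : finType) (x y : T) (s : {perm T}) :
  (#|porbits s| <= #|porbits (tperm x y * s)%g| + 1)%N.
Proof.
have := porbits_mul_tperm s x y; rewrite /=.
have [->|_] := eqVneq x y; first by rewrite porbit_id /=; lia.
by case: (x \notin _) => /=; lia.
Qed.

Lemma porbits_perm1 (T : finType) : #|porbits (1%g : {perm T})| = #|T|.
Proof.
rewrite card_imset // => x y; move/eqP; rewrite eq_porbit_mem.
by case/porbitP => i ->; rewrite expg1n perm1.
Qed.

(** The identity has [n] cycles, and multiplying by a transposition removes at most one. *)
Lemma tcount_ge (n : nat) (s : {perm 'I_n}) : (n <= tcount s + #|porbits s|)%N.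
Proof.
rewrite /tcount; case: ex_minnP => k /existsP[ts /andP[_ /eqP ->]] _.
have := size_tuple ts; move: (tval ts) => l <-; elim: l => [|[x y] l IH] /=.
  by rewrite big_nil porbits_perm1 card_ord.
rewrite big_cons /=.
apply: leq_trans IH _; rewrite addSnnS leq_add2l -addn1.
exact: porbits_tperm_mul_ge.
Qed.

Lemma card_porbits_le (T : finType) (s : {perm T}) : (#|porbits s| <= #|T|)%N.
Proof. exact: leq_imset_card. Qed.

(** Multiplying by [tperm x y] is a bijection from the permutations of [D] fixing [x] onto those
    sending [y] to [x]. *)
Lemma perm_on_tpermM (T : finType) (D : {set T}) (x y : T) (s : {perm T}) :
  x \in D -> y \in D ->
  perm_on D (tperm x y * s)%g && ((tperm x y * s)^-1%g x == y) = perm_on (D :\ x) s.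
Proof.
move=> Dx Dy.
have oT : perm_on D (tperm x y).
  by apply/fintype.subsetP => z; rewrite inE; case: tpermP => [->|->|_ _]; rewrite ?eqxx.
have -> : perm_on D (tperm x y * s)%g = perm_on D s.
  apply/idP/idP => [h|h]; last exact: perm_onM.
  by rewrite -(mulKg (tperm x y) s) tpermV perm_onM.
have -> : ((tperm x y * s)^-1%g x == y) = (s x == x).
  by rewrite (canF_eq (permKV _)) permM tpermR eq_sym.
apply/andP/idP => [[oD /eqP sx]|oD].
  apply/fintype.subsetP => z; rewrite !inE => nz.
  by rewrite (fintype.subsetP oD) ?inE // andbT; apply: contraNneq nz => ->; rewrite sx.
split; last by rewrite (out_perm oD) ?inE ?eqxx.
apply/fintype.subsetP => z nz; have := fintype.subsetP oD z nz.
by rewrite inE => /andP[].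
Qed.

(** The fixed point [x] is a cycle of its own, and the transposition merges it into the cycle of
    [y]. *)
Lemma porbits_tpermM_fix (T : finType) (x y : T) (s : {perm T}) :
  s x = x -> y != x ->
  (#|T| - #|porbits (tperm x y * s)%g| = (#|T| - #|porbits s|).+1)%N.
Proof.
move=> sx nyx; have := porbits_mul_tperm s x y; rewrite /=.
have -> : x \notin porbit s y.
  rewrite porbit_sym; apply: contra nyx => /porbitP[i ->].
  by elim: i => [|i IH]; rewrite ?perm1 // expgSr permM (eqP IH) sx.
rewrite eq_sym nyx /= addn1 => /eqP; rewrite addnS eqSS => /eqP e.
by rewrite -subSn ?card_porbits_le // -e addn1 subSS.
Qed.

(** The generating function of the Stirling numbers of the first kind. Removing a point [x] of [D],
    group by the preimage [y] of [x]: [y = x] contributes a factor 1 and each of the other [k]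
    choices a factor [z]. *)
Lemma sum_porbits_perm_on (R : comNzRingType) (T : finType) (z : R) (D : {set T}) :
  \sum_(s : {perm T} | perm_on D s) z ^+ (#|T| - #|porbits s|)
    = \prod_(i < #|D|) (1 + i%:R * z).
Proof.
elim: {D}#|D| {-2}D (erefl #|D|) => [|k IH] D cD; rewrite cD.
  have -> : D = finset.set0 by apply/eqP; rewrite -cards_eq0 cD.
  rewrite big_ord0 (bigD1 1%g) ?perm_on1 //= porbits_perm1 subnn expr0.
  rewrite big1 ?addr0 // => s /andP[os]; case/eqP; apply/permP => x.
  by rewrite perm1 (out_perm os) ?inE.
have [x Dx] : exists x, x \in D by apply/set0Pn; rewrite -card_gt0 cD.
have cDx : #|D :\ x| = k by move: cD; rewrite (cardsD1 x) Dx => -[].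
rewrite (partition_big (fun s : {perm T} => (s^-1)%g x) (mem D)) /=; last first.
  by move=> s os; rewrite -(perm_closed _ os) permKV.
transitivity (\sum_(y in D) \sum_(s | perm_on (D :\ x) s)
    z ^+ (#|T| - #|porbits (tperm x y * s)%g|)).
  apply: eq_bigr => y Dy; rewrite (reindex_inj (mulgI (tperm x y))) /=.
  by apply: eq_bigl => s; rewrite perm_on_tpermM.
rewrite (bigD1 x) //= tperm1.
under eq_bigr => s _ do rewrite mul1g.
have IHx := IH _ cDx; rewrite cDx in IHx; rewrite IHx big_ord_recr /= mulrDr mulr1; congr (_ + _).
transitivity (\sum_(y in D :\ x) z * \prod_(i < k) (1 + i%:R * z)).
  apply: eq_big => [y|y /andP[Dy nyx]]; first by rewrite !inE andbC.
  rewrite -IHx mulr_sumr; apply: eq_bigr => s os.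
  by rewrite porbits_tpermM_fix ?exprS //; apply: (out_perm os); rewrite !inE eqxx.
by rewrite sumr_const cDx -mulr_natr; ring.
Qed.

Lemma sum_porbits (R : comNzRingType) (T : finType) (z : R) :
  \sum_(s : {perm T}) z ^+ (#|T| - #|porbits s|) = \prod_(i < #|T|) (1 + i%:R * z).
Proof.
rewrite -cardsT -sum_porbits_perm_on; apply: eq_big => [s|s _]; last by rewrite cardsT.
by apply/esym/fintype.subsetP => z' _; rewrite inE.
Qed.

(** * Cycle type and conjugacy *)

Definition ncycles (T : finType) (s : {perm T}) (k : nat) : nat :=
  #|[set B in porbits s | #|B| == k]|.

Lemma iter_porbit_inj (T : finType) (s : {perm T}) (x : T) (i j : nat) :
  (i < #|porbit s x|)%N -> (j < #|porbit s x|)%N ->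
  (s ^+ i)%g x = (s ^+ j)%g x -> i = j.
Proof.
move=> hi hj; rewrite !permX -!(nth_traject _ hi) -?(nth_traject _ hj) => e.
by apply/eqP; rewrite -(nth_uniq x _ _ (uniq_traject_porbit s x)) ?size_traject // e.
Qed.

Lemma porbit_period (T : finType) (s : {perm T}) (x : T) (i : nat) :
  (s ^+ i)%g x = (s ^+ (i %% #|porbit s x|))%g x.
Proof.
have per : (s ^+ #|porbit s x|)%g x = x by rewrite permX iter_porbit.
rewrite {1}(divn_eq i #|porbit s x|) expgD permM; congr (fun_of_perm _ _).
by elim: (i %/ _)%N => [|q IH]; rewrite ?perm1 // mulSn expgD permM per.
Qed.

Lemma porbits_eq (T : finType) (s : {perm T}) (O : {set T}) (x : T) :
  O \in porbits s -> x \in O -> O = porbit s x.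
Proof. by case/imsetP => y _ ->; rewrite -eq_porbit_mem => /eqP. Qed.

(** Sort both lists of cycles by length. The sequences of lengths are sorted permutations of each
    other, hence equal, so cycles at the same position match. *)
Lemma porbits_match (T : finType) (s t : {perm T}) :
  ncycles s =1 ncycles t ->
  exists phi : {set T} -> {set T},
    [/\ {in porbits s, forall O, phi O \in porbits t},
        {in porbits s, forall O, #|phi O| = #|O|} &
        {in porbits s &, injective phi}].
Proof.
move=> E; pose sz (O : {set T}) := #|O|; pose le := relpre sz leq.
pose os (u : {perm T}) := sort le (enum (porbits u)).
have mos u O : (O \in os u) = (O \in porbits u) by rewrite mem_sort mem_enum.
have uos u : uniq (os u) by rewrite sort_uniq enum_uniq.
have Ec : [seq sz B | B <- os s] = [seq sz B | B <- os t].
  apply: (sorted_eq leq_trans anti_leq).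
  - by rewrite sorted_map; apply: sort_sorted => A B; apply: leq_total.
  - by rewrite sorted_map; apply: sort_sorted => A B; apply: leq_total.
  have cnt u k : count_mem k [seq sz B | B <- os u] = ncycles u k.
    rewrite count_map /os count_sort /ncycles -sum1_card -sum1_count big_enum_cond /=.
    by apply: eq_bigl => O; rewrite inE.
  by apply/allP => k _ /=; rewrite !cnt E.
have Es : size (os s) = size (os t) by rewrite -(size_map sz) Ec size_map.
have ilt O : O \in porbits s -> (index O (os s) < size (os s))%N by rewrite index_mem mos.
exists (fun O => nth finset.set0 (os t) (index O (os s))); split.
- by move=> O /ilt lt; rewrite -mos mem_nth // -Es.
- move=> O sO; have lt := ilt O sO.
  have := congr1 (fun l => nth 0%N l (index O (os s))) Ec.
  rewrite !(nth_map finset.set0) -?Es // nth_index ?mos //.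
- move=> O O' sO sO' /eqP; rewrite nth_uniq -?Es ?ilt // => /eqP e.
  by rewrite -(nth_index finset.set0 (s := os s) (x := O)) ?mos // e nth_index ?mos.
Qed.

(* Match the cycles of [s] with cycles of [t] of the same length, pick a base
   point on each, and conjugate by the map transporting [s ^ i] of a base point
   to [t ^ i] of the matching one. *)
Lemma conj_of_ncycles (T : finType) (s t : {perm T}) :
  ncycles s =1 ncycles t -> exists h : {perm T}, t = (s ^ h)%g.
Proof.
move=> /porbits_match[phi [phiP phi_card phi_inj]].
have [x0 _|T0] := pickP (fun _ : T => true); last first.
  by exists 1%g; apply/permP => x; have := T0 x.
pose r (O : {set T}) := odflt x0 [pick x in O].
have rP u O : O \in porbits u -> r O \in O.
  case/imsetP => y _ ->; rewrite /r; case: pickP => // /(_ y).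
  by rewrite porbit_id.
have prb u O : O \in porbits u -> porbit u (r O) = O.
  by move=> uO; rewrite -(porbits_eq uO (rP u O uO)).
pose base x := r (porbit s x).
pose base' x := r (phi (porbit s x)).
have sO x : porbit s x \in porbits s by apply: imset_f.
have tO x : phi (porbit s x) \in porbits t by apply: phiP.
have exi x : exists i, (i < #|porbit s x|)%N && (x == (s ^+ i)%g (base x)).
  have : x \in porbit s (base x) by rewrite (prb s) ?porbit_id.
  case/porbitP => i e; exists (i %% #|porbit s x|)%N.
  rewrite ltn_mod lt0n card_porbit_neq0 /=; apply/eqP.
  by rewrite {1}e porbit_period (prb s).
pose idx x := ex_minn (exi x).
have idxP x : (idx x < #|porbit s x|)%N /\ x = (s ^+ idx x)%g (base x).
  by rewrite /idx; case: ex_minnP => i /andP[lt /eqP e] _.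
pose g x := (t ^+ idx x)%g (base' x).
(* Any exponent reaching [x] may replace [idx x]: the two agree modulo the length shared by the
   matched cycles. *)
have gE x i : x = (s ^+ i)%g (base x) -> g x = (t ^+ i)%g (base' x).
  move=> e; have [lt e'] := idxP x; rewrite /g [RHS]porbit_period (prb t) // phi_card //.
  suff -> : idx x = (i %% #|porbit s x|)%N by [].
  apply: (@iter_porbit_inj _ s (base x)); rewrite ?(prb s) //.
    by rewrite ltn_mod lt0n card_porbit_neq0.
  by rewrite -e' {1}e porbit_period (prb s).
have gO x : phi (porbit s x) = porbit t (g x).
  by apply: porbits_eq => //; have := mem_porbit t (idx x) (base' x); rewrite (prb t).
have ginj : injective g.
  move=> x y e; have Oxy : porbit s x = porbit s y.
    by apply: phi_inj => //; rewrite !gO e.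
  have [lx ex] := idxP x; have [ly ey] := idxP y.
  suff ei : idx x = idx y by rewrite ex ey /base Oxy ei.
  apply: (@iter_porbit_inj _ t (base' y)); rewrite ?(prb t) // ?phi_card //.
    by rewrite -Oxy.
  by move: e; rewrite /g /base' Oxy.
exists (perm ginj); rewrite conjgE; apply: (mulgI (perm ginj)); rewrite mulKVg.
apply/permP => x; rewrite !permM !permE.
have sx : porbit s (s x) = porbit s x by rewrite -(porbit_perm s 1 x) expg1.
have [_ e] := idxP x.
rewrite (gE (s x) (idx x).+1); first by rewrite expgSr permM /base' sx.
by rewrite expgSr permM /base sx -e.
Qed.

(** * The number of irreducible characters of the symmetric group *)

Lemma ncycles_le (T : finType) (s : {perm T}) (k : nat) : (ncycles s k <= #|T|)%N.
Proof.
apply: leq_trans (card_porbits_le s); apply: subset_leq_card.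
by apply/fintype.subsetP => B; rewrite inE => /andP[].
Qed.

Lemma sum_ncycles (n : nat) (s : {perm 'I_n}) :
  (\sum_(i < n) i.+1 * ncycles s i.+1 = n)%N.
Proof.
transitivity (\sum_(B in porbits s) #|B|)%N; last first.
  rewrite -[RHS](card_ord n) -[RHS]sum1_card.
  rewrite (partition_big (porbit s) (mem (porbits s))) /=; last by move=> x _; apply: imset_f.
  apply: eq_bigr => B sB; rewrite -sum1_card; apply: eq_bigl => x /=.
  apply/idP/eqP => [xB|<-]; last exact: porbit_id.
  by rewrite -(porbits_eq sB xB).
have lt0B B : B \in porbits s -> (0 < #|B|)%N.
  by case/imsetP => x _ ->; rewrite lt0n card_porbit_neq0.
case: n s lt0B => [|n] s lt0B.
  by rewrite big_ord0 big1 // => B _; apply/eqP; rewrite -leqn0 -[X in (_ <= X)%N](card_ord 0) max_card.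
have ltBn (B : {set 'I_n.+1}) : (#|B| <= n.+1)%N.
  by rewrite -[X in (_ <= X)%N](card_ord n.+1) max_card.
(* Index [i] stands for cycle length [i + 1]. Lengths lie between 1 and [n + 1] here, so [inord]
   returns its argument and not the default. *)
rewrite [RHS](partition_big (fun B : {set 'I_n.+1} => inord #|B|.-1 : 'I_n.+1) xpredT) //=.
apply: eq_bigr => i _.
rewrite (eq_bigr (fun _ => i.+1)) => [|B /andP[sB /eqP ei]].
  rewrite sum_nat_const mulnC /ncycles; congr (_ * _)%N.
  apply: eq_card => B; rewrite !inE unfold_in.
  apply/andP/andP => -[sB /eqP e]; have lt0 := lt0B _ sB; have ltn := ltBn B.
    by split=> //; apply/eqP/val_inj; rewrite /= inordK ?prednK // e.
  by split=> //; rewrite -e inordK prednK.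
have lt0 := lt0B _ sB; have ltn := ltBn B.
by rewrite -ei inordK prednK.
Qed.

(** Entry [i] counts the cycles of length [i + 1]; counts never exceed [n], so [inord] loses nothing
    and cycle types live in a finite type. *)
Definition cycle_type (n : nat) (s : {perm 'I_n}) : {ffun 'I_n -> 'I_n.+1} :=
  [ffun i : 'I_n => inord (ncycles s i.+1)].

Lemma cycle_typeE (n : nat) (s : {perm 'I_n}) (i : 'I_n) :
  cycle_type s i = ncycles s i.+1 :> nat.
Proof. by rewrite ffunE inordK // ltnS -[X in (_ <= X)%N](card_ord n) ncycles_le. Qed.

Lemma cycle_type_conj (n : nat) (s t : {perm 'I_n}) :
  cycle_type s = cycle_type t -> exists h : {perm 'I_n}, t = (s ^ h)%g.
Proof.
move=> e; apply: conj_of_ncycles => k.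
have big u k' : (n < k')%N -> ncycles (u : {perm 'I_n}) k' = 0%N.
  move=> lt; apply: eq_card0 => B; rewrite inE; apply/negbTE; rewrite negb_and orbC.
  by rewrite neq_ltn (leq_ltn_trans (max_card _)) ?card_ord.
have zero u : ncycles (u : {perm 'I_n}) 0 = 0%N.
  apply: eq_card0 => B; rewrite inE; apply/negbTE; rewrite negb_and.
  by case: imsetP => //= -[x _ ->]; rewrite card_porbit_neq0.
case: k => [|k]; first by rewrite !zero.
have [lt|le] := ltnP k n; last by rewrite !big.
by rewrite -!(cycle_typeE _ (Ordinal lt)) e.
Qed.

(** Irreducibles are as many as conjugacy classes, and a class is determined by its cycle type, a
    partition of [n] given by multiplicities. *)
Lemma Nirr_Sym_le (n : nat) :
  (Nirr (SymG n) <= #|[set f : {ffun 'I_n -> 'I_n.+1} | \sum_(i < n) i.+1 * f i == n]|)%N.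
Proof.
rewrite NirrE -(card_in_imset (f := fun C => cycle_type (repr C))).
  apply: subset_leq_card; apply/fintype.subsetP => _ /imsetP[C _ ->]; rewrite inE.
  by under eq_bigr => i _ do rewrite cycle_typeE; rewrite sum_ncycles.
move=> C D /repr_classesP[_ eC] /repr_classesP[_ eD] /cycle_type_conj[h e].
by rewrite eC eD e classGidl ?inE.
Qed.

(** Euler's product for the partition generating function: expanding truncated geometric series
    yields a term [x ^+ n] for each partition of [n]. *)
Lemma Nirr_Sym_gen (R : realFieldType) (n : nat) (x : R) : 0 < x < 1 ->
  (Nirr (SymG n))%:R * x ^+ n <= \prod_(i < n) (1 - x ^+ i.+1)^-1.
Proof.
case/andP=> x0 x1.
have xn i : 0 <= x ^+ i by rewrite exprn_ge0 ?ltW.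
have xn1 i : x ^+ i.+1 < 1 by rewrite exprn_ilt1 ?ltW.
apply: (@le_trans _ _ (\sum_(f : {ffun 'I_n -> 'I_n.+1}) \prod_(i < n) x ^+ (i.+1 * f i))).
  apply: (@le_trans _ _ (#|[set f : {ffun 'I_n -> 'I_n.+1} | \sum_(i < n) i.+1 * f i == n]|%:R * x ^+ n)).
    by rewrite ler_wpM2r // ler_nat Nirr_Sym_le.
  rewrite mulr_natl -sumr_const big_mkcond; apply: ler_sum => f _; rewrite inE.
  case: eqP => [e|_]; last by apply: prodr_ge0.
  by rewrite -{1}e -expr_sum.
rewrite -(bigA_distr_bigA (fun (i : 'I_n) (k : 'I_n.+1) => x ^+ (i.+1 * k))).
apply: ler_prod => i _; rewrite sumr_ge0 //=.
have d0 : 0 < 1 - x ^+ i.+1 by rewrite subr_gt0.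
rewrite -[leRHS]mul1r ler_pdivlMr // mulrC.
under eq_bigr => k _ do rewrite exprM.
by rewrite -opprB mulNr -subrX1 opprB lerBlDr lerDl exprn_ge0.
Qed.

(** * Characters of the wreath product *)

Definition sum_map (n : nat) (p : {perm 'I_n} * {perm 'I_n}) (u : 'I_n + 'I_n) :=
  match u with inl j => inl (p.1 j) | inr j => inr (p.2 j) end.

Definition emb_fun (n : nat) (p : {perm 'I_n} * {perm 'I_n}) (i : 'I_(n + n)) :
    'I_(n + n) := unsplit (sum_map p (fintype.split i)).

Lemma emb_fun_inj (n : nat) (p : {perm 'I_n} * {perm 'I_n}) : injective (emb_fun p).
Proof.
move=> i j /(can_inj (@unsplitK n n)) e; apply: (can_inj (@splitK n n)).
by move: e; case: (fintype.split i) => a; case: (fintype.split j) => b //= [] /perm_inj ->.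
Qed.

Definition emb (n : nat) (p : {perm 'I_n} * {perm 'I_n}) : {perm 'I_(n + n)} :=
  perm (@emb_fun_inj n p).

Definition swp_fun (n : nat) (i : 'I_(n + n)) : 'I_(n + n) :=
  unsplit (match fintype.split i with inl j => inr j | inr j => inl j end).

Lemma swp_funK (n : nat) : involutive (@swp_fun n).
Proof.
move=> i; rewrite /swp_fun unsplitK -[RHS](@splitK n n).
by case: (fintype.split i).
Qed.

Definition swp (n : nat) : {perm 'I_(n + n)} := perm (inv_inj (@swp_funK n)).

Lemma emb_unsplit (n : nat) (p : {perm 'I_n} * {perm 'I_n}) (u : 'I_n + 'I_n) :
  emb p (unsplit u) = unsplit (sum_map p u).
Proof. by rewrite permE /emb_fun unsplitK. Qed.

Lemma swp_unsplit (n : nat) (u : 'I_n + 'I_n) :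
  swp n (unsplit u) = unsplit (match u with inl j => inr j | inr j => inl j end).
Proof. by rewrite permE /swp_fun unsplitK. Qed.

Lemma lside_unsplit (n : nat) (u : 'I_n + 'I_n) : lside (unsplit u) = is_inl u.
Proof. by case: u => j; rewrite /lside /= ?ltn_ord // ltnNge leq_addr. Qed.

Lemma unsplitP (n : nat) (P : 'I_(n + n) -> Prop) :
  (forall u, P (unsplit u)) -> forall i, P i.
Proof. by move=> h i; rewrite -(@splitK n n i). Qed.

Lemma embM (n : nat) : {morph @emb n : p q / (p * q)%g}.
Proof.
move=> p q; apply/permP; apply: unsplitP => u.
by rewrite permM !emb_unsplit; case: u => j /=; rewrite permM.
Qed.

Lemma emb_inj (n : nat) : injective (@emb n).
Proof.
move=> [a b] [c d] e; congr (_, _); apply/permP => j.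
  have := congr1 (fun s : {perm _} => s (unsplit (inl j))) e.
  by rewrite !emb_unsplit => /(can_inj (@unsplitK n n)) [].
have := congr1 (fun s : {perm _} => s (unsplit (inr j))) e.
by rewrite !emb_unsplit => /(can_inj (@unsplitK n n)) [].
Qed.

Lemma emb_swpJ (n : nat) (a b : {perm 'I_n}) : (emb (a, b) ^ swp n)%g = emb (b, a).
Proof.
apply: (mulgI (swp n)); rewrite conjgE mulKVg; apply/permP; apply: unsplitP => u.
by rewrite !permM; case: u => j; rewrite ?(emb_unsplit, swp_unsplit) /= ?emb_unsplit ?swp_unsplit.
Qed.

Canonical emb_morphism (n : nat) :=
  @Morphism _ _ [set: {perm 'I_n} * {perm 'I_n}] (@emb n) (in2W (@embM n)).

Definition base_group (n : nat) : {group {perm 'I_(n + n)}} :=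
  (emb_morphism n @* [set: {perm 'I_n} * {perm 'I_n}])%G.

(** The bit [b] tells whether the sides are exchanged; keeping it as a parameter makes it additive
    under products. *)
Definition side_shift (n : nat) (b : bool) (p : {perm 'I_(n + n)}) : bool :=
  [forall i, lside (p i) == lside i (+) b].

Lemma side_shiftM (n : nat) (b c : bool) (p q : {perm 'I_(n + n)}) :
  side_shift b p -> side_shift c q -> side_shift (b (+) c) (p * q)%g.
Proof.
move=> /forallP hp /forallP hq; apply/forallP => i.
by rewrite permM (eqP (hq _)) (eqP (hp _)) addbA.
Qed.

Lemma side_shiftV (n : nat) (b : bool) (p : {perm 'I_(n + n)}) :
  side_shift b p -> side_shift b p^-1%g.
Proof.
move=> /forallP hp; apply/forallP => i; have := hp ((p^-1)%g i).
by rewrite permKV => /eqP ->; rewrite addbK.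
Qed.

Lemma side_shift_emb (n : nat) (p : {perm 'I_n} * {perm 'I_n}) : side_shift false (emb p).
Proof.
apply/forallP; apply: unsplitP => u; rewrite emb_unsplit !lside_unsplit.
by case: u.
Qed.

Lemma side_shift_swp (n : nat) : side_shift true (swp n).
Proof.
apply/forallP; apply: unsplitP => u; rewrite swp_unsplit !lside_unsplit.
by case: u.
Qed.

Lemma side_shift_uniq (n : nat) (b c : bool) (p : {perm 'I_(n + n)}) : (0 < n)%N ->
  side_shift b p -> side_shift c p -> b = c.
Proof.
move=> n0 /forallP hb /forallP hc; pose i : 'I_(n + n) := lshift n (Ordinal n0).
by move: (hb i) (hc i) => /eqP -> /eqP /addbI.
Qed.

Lemma base_groupP (n : nat) (g : {perm 'I_(n + n)}) :
  (g \in base_group n) = side_shift false g.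
Proof.
apply/idP/idP => [|/forallP hg]; first by case/morphimP => p _ _ ->; apply: side_shift_emb.
have hl j : {k | g (unsplit (inl j)) = unsplit (inl k)}.
  have := hg (unsplit (inl j)); rewrite -[g _](@splitK n n) !lside_unsplit.
  by case: (fintype.split _) => // k _; exists k.
have hr j : {k | g (unsplit (inr j)) = unsplit (inr k)}.
  have := hg (unsplit (inr j)); rewrite -[g _](@splitK n n) !lside_unsplit.
  by case: (fintype.split _) => // k _; exists k.
have il : injective (fun j => sval (hl j)).
  move=> j k; case: (hl j) (hl k) => j' /= ej [k' /= ek] e.
  have : g (unsplit (inl j)) = g (unsplit (inl k)) by rewrite ej ek e.
  by move=> /perm_inj/(can_inj (@unsplitK n n)) [].
have ir : injective (fun j => sval (hr j)).
  move=> j k; case: (hr j) (hr k) => j' /= ej [k' /= ek] e.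
  have : g (unsplit (inr j)) = g (unsplit (inr k)) by rewrite ej ek e.
  by move=> /perm_inj/(can_inj (@unsplitK n n)) [].
have -> : g = emb (perm il, perm ir).
  apply/permP; apply: unsplitP => u; rewrite emb_unsplit.
  by case: u => j /=; rewrite permE; [apply: svalP (hl j) | apply: svalP (hr j)].
by apply: (@mem_morphim _ _ _ (emb_morphism n)); rewrite finset.in_setT.
Qed.

(** The permutations preserving the bipartition already form a group, so generation adds no
    element. *)
Lemma WrP (n : nat) (g : {perm 'I_(n + n)}) :
  (g \in Wr n) = side_shift false g || side_shift true g.
Proof.
have E p : bip_preserving p = side_shift false p || side_shift true (p : {perm 'I_(n + n)}).
  by rewrite /bip_preserving /flip /side_shift; congr (_ || _);
     apply: eq_forallb => i; rewrite ?addbF ?addbT.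
have gS : group_set [set p : {perm 'I_(n + n)} | bip_preserving p].
  apply/group_setP; split=> [|p q].
    by rewrite inE E; apply/orP; left; apply/forallP => i; rewrite perm1 addbF.
  rewrite !inE !E => /orP[] hp /orP[] hq; have := side_shiftM hp hq => /= ->;
    by rewrite ?orbT.
by rewrite -E /= (gen_set_id gS) inE.
Qed.

Lemma base_group_sub (n : nat) : base_group n \subset Wr n.
Proof. by apply/fintype.subsetP => g; rewrite base_groupP WrP => ->. Qed.

Lemma sum_base_group (V : nmodType) (n : nat) (f : {perm 'I_(n + n)} -> V) :
  \sum_(g in base_group n) f g = \sum_(p : {perm 'I_n} * {perm 'I_n}) f (emb p).
Proof.
have -> : (base_group n : {set _}) = [set emb p | p in [set: {perm 'I_n} * {perm 'I_n}]].
  by rewrite /= morphimEdom.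
rewrite big_imset /=; last by move=> p q _ _; apply: emb_inj.
by apply: eq_bigl => p; rewrite !inE.
Qed.

(** For [0 < n] the swap gives a second coset disjoint from the base group; for [n = 0] the two
    would coincide. *)
Lemma sum_Wr (V : nmodType) (n : nat) (f : {perm 'I_(n + n)} -> V) : (0 < n)%N ->
  \sum_(g in Wr n) f g
    = \sum_(g in base_group n) f g + \sum_(g in base_group n) f (swp n * g)%g.
Proof.
move=> n0; rewrite (bigID (fun g => g \in base_group n)); congr (_ + _).
  by apply: eq_bigl => g; rewrite WrP !base_groupP; case: (side_shift false g); rewrite ?andbF.
rewrite (reindex_inj (mulgI (swp n))); apply: eq_bigl => g.
rewrite WrP !base_groupP; apply/idP/idP => [|hg].
  case: (side_shift false _) => //=; rewrite andbT => h.
  by have := side_shiftM (side_shiftV (side_shift_swp n)) h; rewrite mulKg.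
have h := side_shiftM (side_shift_swp n) hg; rewrite h orbT /=.
by apply/negP => h'; have := side_shift_uniq n0 h h'.
Qed.

Lemma card_base_group (n : nat) : #|base_group n| = (n`! ^ 2)%N.
Proof.
rewrite /= morphimEdom card_imset; last exact: emb_inj.
by rewrite cardsT card_prod card_Sn.
Qed.

Lemma card_Wr (n : nat) : (0 < n)%N -> #|Wr n| = (2 * n`! ^ 2)%N.
Proof.
move=> n0; have := sum_Wr (fun _ => 1%N) n0.
rewrite !sum1_card card_base_group => ->.
by rewrite mul2n -addnn.
Qed.

(** The pullback of ['chi_i] along the first projection; the restriction only casts it to the image
    of the projection, as [cfMorph] expects. *)
Definition fst_cfun (n : nat) (i : Iirr (SymG n)) : 'CF([set: {perm 'I_n} * {perm 'I_n}]) :=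
  cfMorph ('Res[@fst_morphism {perm 'I_n} {perm 'I_n} @* [set: {perm 'I_n} * {perm 'I_n}]] 'chi_i).
Definition snd_cfun (n : nat) (i : Iirr (SymG n)) : 'CF([set: {perm 'I_n} * {perm 'I_n}]) :=
  cfMorph ('Res[@snd_morphism {perm 'I_n} {perm 'I_n} @* [set: {perm 'I_n} * {perm 'I_n}]] 'chi_i).

Lemma fst_cfunE (n : nat) (i : Iirr (SymG n)) (p : {perm 'I_n} * {perm 'I_n}) :
  fst_cfun i p = 'chi_i p.1.
Proof.
rewrite cfMorphE ?finset.in_setT // cfResE ?finset.subsetT //.
by apply: (@mem_morphim _ _ _ (@fst_morphism _ _)); rewrite finset.in_setT.
Qed.

Lemma snd_cfunE (n : nat) (i : Iirr (SymG n)) (p : {perm 'I_n} * {perm 'I_n}) :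
  snd_cfun i p = 'chi_i p.2.
Proof.
rewrite cfMorphE ?finset.in_setT // cfResE ?finset.subsetT //.
by apply: (@mem_morphim _ _ _ (@snd_morphism _ _)); rewrite finset.in_setT.
Qed.

Lemma emb_isom (n : nat) :
  isom [set: {perm 'I_n} * {perm 'I_n}] (base_group n) (emb_morphism n).
Proof. by apply/isomP; split=> //; apply/injmP => p q _ _; apply: emb_inj. Qed.

(** * Characters induced from the base group *)

Definition outer_char (n : nat) (i j : Iirr (SymG n)) : 'CF(base_group n) :=
  cfIsom (emb_isom n) (fst_cfun i * snd_cfun j).

Lemma outer_charE (n : nat) (i j : Iirr (SymG n)) (p : {perm 'I_n} * {perm 'I_n}) :
  outer_char i j (emb p) = 'chi_i p.1 * 'chi_j p.2.
Proof.
rewrite /outer_char (cfIsomE (emb_isom n) _ (finset.in_setT p)) cfunE.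
by rewrite fst_cfunE snd_cfunE.
Qed.

Lemma outer_char_char (n : nat) (i j : Iirr (SymG n)) : outer_char i j \is a character.
Proof.
by rewrite cfIsom_char rpredM // cfMorph_char // cfRes_char // irr_char.
Qed.

Definition sym_char (n : nat) (i j : Iirr (SymG n)) : 'CF(Wr n) :=
  'Ind[Wr n] (outer_char i j).

Lemma sym_charE (n : nat) (i j : Iirr (SymG n)) (a b : {perm 'I_n}) : (0 < n)%N ->
  sym_char i j (emb (a, b)) = 'chi_i a * 'chi_j b + 'chi_j a * 'chi_i b.
Proof.
move=> n0; rewrite cfIndE ?base_group_sub // sum_Wr //.
rewrite (eq_bigr (fun _ => outer_char i j (emb (a, b)))) => [|g Ng]; last by rewrite cfunJ.
rewrite [X in _ + X](eq_bigr (fun _ => outer_char i j (emb (b, a)))) => [|g Ng]; last first.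
  by rewrite conjgM emb_swpJ cfunJ.
rewrite !sumr_const !outer_charE -mulrnDl -[(_ + _) *+ _]mulr_natl mulKf ?neq0CG //=.
by rewrite ['chi_i b * _]mulrC.
Qed.

(** The base group is normal, so an element outside it has no conjugate inside. *)
Lemma sym_char_out (n : nat) (i j : Iirr (SymG n)) (g : {perm 'I_(n + n)}) :
  g \notin base_group n -> sym_char i j g = 0.
Proof.
move=> nNg; rewrite cfIndE ?base_group_sub // big1 ?mulr0 // => y Gy.
apply: cfun0; apply: contra nNg; rewrite !base_groupP conjgE.
have {Gy} : exists b, side_shift b y.
  by move: Gy; rewrite WrP => /orP[]; [exists false | exists true].
case=> b hb h; have := side_shiftM (side_shiftM hb h) (side_shiftV hb).
by rewrite addbF addbb !mulgA mulgV mul1g mulgK.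
Qed.

Lemma sym_char_char (n : nat) (i j : Iirr (SymG n)) : sym_char i j \is a character.
Proof. by apply: cfInd_char; apply: outer_char_char. Qed.

Lemma card_SymG (n : nat) : #|SymG n| = n`!.
Proof. by rewrite cardsT card_Sn. Qed.

Lemma sum_Sym_irr (n : nat) (i j : Iirr (SymG n)) :
  \sum_(a : {perm 'I_n}) 'chi_i a * ('chi_j a)^* = (n`!)%:R * (i == j)%:R.
Proof.
have := cfdot_irr i j; rewrite cfdotE card_SymG => <-.
rewrite mulVKf ?pnatr_eq0 -?lt0n ?fact_gt0 //.
by apply: eq_bigl => a; rewrite finset.in_setT.
Qed.

(** Frobenius reciprocity moves the product to the base group, where the sum factors and
    orthogonality applies on each side. *)
Lemma cfdot_sym_char (n : nat) (i j k l : Iirr (SymG n)) : (0 < n)%N ->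
  '[sym_char i j, sym_char k l] = ((i == k) && (j == l))%:R + ((i == l) && (j == k))%:R.
Proof.
move=> n0; rewrite -Frobenius_reciprocity cfdotE card_base_group.
rewrite sum_base_group.
transitivity ((n`! ^ 2)%:R^-1 * \sum_(p : {perm 'I_n} * {perm 'I_n})
   ('chi_i p.1 * ('chi_k p.1)^* * ('chi_j p.2 * ('chi_l p.2)^*)
  + 'chi_i p.1 * ('chi_l p.1)^* * ('chi_j p.2 * ('chi_k p.2)^*))).
  congr (_ * _); apply: eq_bigr => -[a b] _.
  rewrite cfResE ?base_group_sub //; last first.
    by apply: (@mem_morphim _ _ _ (emb_morphism n)); rewrite finset.in_setT.
  by rewrite outer_charE sym_charE //= rmorphD !rmorphM /=; ring.
have S (f g : {perm 'I_n} -> algC) : \sum_(p : {perm 'I_n} * {perm 'I_n}) f p.1 * g p.2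
    = (\sum_a f a) * (\sum_b g b).
  by rewrite big_distrlr pair_big /=.
rewrite big_split /= (S (fun a => 'chi_i a * ('chi_k a)^*) (fun b => 'chi_j b * ('chi_l b)^*)).
rewrite (S (fun a => 'chi_i a * ('chi_l a)^*) (fun b => 'chi_j b * ('chi_k b)^*)).
rewrite !sum_Sym_irr -!mulnb !natrM; field.
by rewrite pnatr_eq0 -lt0n fact_gt0.
Qed.

Lemma sym_char1 (n : nat) (i j : Iirr (SymG n)) : (0 < n)%N ->
  sym_char i j 1%g = 2 * ('chi_i 1%g * 'chi_j 1%g).
Proof.
move=> n0; have -> : 1%g = emb (1%g, 1%g) :> {perm 'I_(n + n)}.
  by apply/permP; apply: unsplitP => -[] k; rewrite emb_unsplit /= !perm1.
by rewrite sym_charE //; ring.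
Qed.

Lemma sym_char_irr (n : nat) (i j : Iirr (SymG n)) : (0 < n)%N -> i != j ->
  sym_char i j \in irr (Wr n).
Proof.
move=> n0 nij; rewrite irrEchar sym_char_char cfdot_sym_char // !eqxx.
by rewrite (negPf nij) /= addr0.
Qed.

(** The inner product of the two characters is then 1, which forces one of the two indicator terms
    of [cfdot_sym_char]. *)
Lemma sym_char_eq (n : nat) (i j k l : Iirr (SymG n)) : (0 < n)%N -> i != j ->
  sym_char i j = sym_char k l -> (k, l) \in [:: (i, j); (j, i)].
Proof.
move=> n0 nij e; have := cfdot_sym_char i j i j n0; rewrite {2}e cfdot_sym_char //.
rewrite !eqxx (negPf nij) /= addr0 !inE !xpair_eqE.
rewrite [k == i]eq_sym [l == j]eq_sym [l == i]eq_sym [k == j]eq_sym.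
case: (_ && _) => //=; rewrite andbC; case: (_ && _) => //=.
by rewrite addr0 => /eqP; rewrite eq_sym oner_eq0.
Qed.

(** * Good irreducibles and their Plancherel weight *)

Section GoodIrreps.
Variables (n : nat) (D : pred (Iirr (SymG n))).
Hypothesis n_gt0 : (0 < n)%N.

Definition good_pair (p : Iirr (SymG n) * Iirr (SymG n)) : bool :=
  [&& p.1 != p.2, D p.1 & D p.2].

Definition good_irr (i : Iirr (Wr n)) : bool :=
  [exists p, good_pair p && ('chi_i == sym_char p.1 p.2)].

Lemma good_irr_out (i : Iirr (Wr n)) : good_irr i ->
  forall g, g \notin base_group n -> 'chi_i g = 0.
Proof. by case/existsP => p /andP[_ /eqP ->] g; apply: sym_char_out. Qed.

(** A good irreducible arises from at most two ordered pairs, [(k, l)] and [(l, k)]. *)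
Lemma sum_good_ge :
  \sum_(p | good_pair p) sym_char p.1 p.2 1%g ^+ 2
    <= 2 * \sum_(i | good_irr i) 'chi_i 1%g ^+ 2.
Proof.
pose e (p : Iirr (SymG n) * Iirr (SymG n)) : Iirr (Wr n) := cfIirr (sym_char p.1 p.2).
have eE p : good_pair p -> 'chi_(e p) = sym_char p.1 p.2.
  by case/and3P => np _ _; rewrite /e cfIirrE // sym_char_irr.
rewrite (partition_big e good_irr) /=; last first.
  by move=> p gp; apply/existsP; exists p; rewrite gp eE /=.
rewrite mulr_sumr; apply: ler_sum => i /existsP[[k l] /andP[gkl /eqP ei]].
rewrite (eq_bigr (fun _ => 'chi_i 1%g ^+ 2)) => [|p /andP[gp /eqP <-]]; last by rewrite eE.
rewrite sumr_const -[(_ ^+ 2) *+ _]mulr_natl.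
apply: ler_wpM2r; first by rewrite exprn_ge0 // ltW // irr1_gt0.
rewrite ler_nat.
apply: (@leq_trans #|[:: (k, l); (l, k)]|); last exact: card_size.
apply: subset_leq_card; apply/fintype.subsetP => -[k' l'].
rewrite unfold_in => /andP[gp /eqP epi].
apply: sym_char_eq => //; first by case/and3P: gkl.
by rewrite -ei -epi eE.
Qed.

(** By [sum_good_ge] the good pairs are fully accounted for by good irreducibles, so the bad weight
    is at most the product Plancherel weight of the bad pairs. Diagonal pairs give the fourth
    powers; a member outside [D], in either position, gives the second term and its factor 2. *)
Lemma bad_irr_weight :
  \sum_(i | ~~ good_irr i) 'chi_i 1%g ^+ 2 / #|Wr n|%:R
    <= (\sum_(i : Iirr (SymG n)) 'chi_i 1%g ^+ 4) / (n`!)%:R ^+ 2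
       + 2 * (\sum_(i : Iirr (SymG n) | ~~ D i) 'chi_i 1%g ^+ 2) / (n`!)%:R.
Proof.
pose f (p : Iirr (SymG n) * Iirr (SymG n)) : algC := ('chi_p.1 1%g * 'chi_p.2 1%g) ^+ 2.
have d0 (G : {group _}) (i : Iirr (G : {group {perm 'I_n}})) : 0 <= 'chi_i 1%g by rewrite ltW ?irr1_gt0.
have f0 p : 0 <= f p by rewrite exprn_ge0 ?mulr_ge0.
have N0 : (n`!)%:R != 0 :> algC by rewrite pnatr_eq0 -lt0n fact_gt0.
have Ng0 : 0 < (n`!)%:R :> algC by rewrite ltr0n fact_gt0.
have sumf : \sum_p f p = (n`!)%:R ^+ 2.
  rewrite -card_SymG -(irr_sum_square (SymG n)) expr2 big_distrlr pair_big /=.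
  by apply: eq_bigr => p _; rewrite /f exprMn.
have G2 : #|Wr n|%:R = 2 * (n`!)%:R ^+ 2 :> algC by rewrite card_Wr // natrM natrX.
have tot := irr_sum_square (Wr n); rewrite (bigID good_irr) /= in tot.
have hg := sum_good_ge.
rewrite (eq_bigr (fun p => 4 * f p)) in hg; last first.
  by move=> p _; rewrite sym_char1 // /f; ring.
rewrite -mulr_sumr in hg.
have bad : \sum_(p | ~~ good_pair p) f p <=
    (\sum_(i : Iirr (SymG n)) 'chi_i 1%g ^+ 4)
     + 2 * (n`!)%:R * \sum_(i : Iirr (SymG n) | ~~ D i) 'chi_i 1%g ^+ 2.
  have -> : \sum_(i : Iirr (SymG n)) 'chi_i 1%g ^+ 4
      = \sum_(p : Iirr (SymG n) * Iirr (SymG n)) (if p.1 == p.2 then f p else 0).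
    rewrite -(pair_big xpredT xpredT (fun i j => if i == j then f (i, j) else 0)) /=.
    apply: eq_bigr => i _; rewrite (bigD1 i) //= eqxx big1 ?addr0 => [|j /negPf nj].
      by rewrite /f /=; ring.
    by rewrite eq_sym nj.
  have E1 : (n`!)%:R * \sum_(i : Iirr (SymG n) | ~~ D i) 'chi_i 1%g ^+ 2
      = \sum_(p : Iirr (SymG n) * Iirr (SymG n)) (if ~~ D p.1 then f p else 0).
    rewrite -card_SymG -(irr_sum_square (SymG n)) mulrC big_distrlr /=.
    rewrite pair_big big_mkcond /=; apply: eq_bigr => p _.
    by rewrite andbT /f exprMn.
  have E2 : (n`!)%:R * \sum_(i : Iirr (SymG n) | ~~ D i) 'chi_i 1%g ^+ 2
      = \sum_(p : Iirr (SymG n) * Iirr (SymG n)) (if ~~ D p.2 then f p else 0).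
    rewrite -card_SymG -(irr_sum_square (SymG n)) big_distrlr /=.
    rewrite pair_big big_mkcond /=; apply: eq_bigr => p _.
    by rewrite /f exprMn.
  rewrite -mulrA mulrDl mul1r {1}E1 E2 -!big_split big_mkcond /=; apply: ler_sum => p _.
  have h := f0 p; rewrite /good_pair.
  case: (p.1 == p.2); case: (D p.1); case: (D p.2) => /=;
    by rewrite ?addr0 ?add0r ?lexx ?lerDl ?addr_ge0.
rewrite -mulr_suml G2 ler_pdivrMr ?mulr_gt0 ?exprn_gt0 //.
have -> : ((\sum_(i : Iirr (SymG n)) 'chi_i 1%g ^+ 4) / (n`!)%:R ^+ 2 +
   2 * (\sum_(i : Iirr (SymG n) | ~~ D i) 'chi_i 1%g ^+ 2) / (n`!)%:R) * (2 * (n`!)%:R ^+ 2)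
   = 2 * ((\sum_(i : Iirr (SymG n)) 'chi_i 1%g ^+ 4)
     + 2 * (n`!)%:R * \sum_(i : Iirr (SymG n) | ~~ D i) 'chi_i 1%g ^+ 2).
  by field.
apply: le_trans (ler_wpM2l (ler0n _ 2) bad).
move: sumf; rewrite (bigID good_pair) /= => sumf.
rewrite -(lerD2l (\sum_(i | good_irr i) 'chi_i 1%g ^+ 2)) tot G2 -sumf mulrDr lerD2r.
rewrite -(ler_pM2l (ltr0n _ 2)); apply: le_trans hg.
by rewrite mulrA -natrM.
Qed.

Lemma good_irr_bound (z : algC) (i : Iirr (Wr n)) (p : {perm 'I_n} * {perm 'I_n}) :
  (forall j, D j -> forall a, `|'chi_j a| <= 'chi_j 1%g * z ^+ (n - #|porbits a|)) ->
  0 <= z -> good_irr i ->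
  `|'chi_i (emb p)| <= 'chi_i 1%g * (z ^+ (n - #|porbits p.1|) * z ^+ (n - #|porbits p.2|)).
Proof.
move=> hD z0 /existsP[[k l] /andP[/and3P[_ Dk Dl] /eqP ->]]; case: p => a b /=.
rewrite sym_char1 // sym_charE //; apply: le_trans (ler_normD _ _) _.
rewrite !normrM; set x := z ^+ _; set y := z ^+ _.
have -> : 2 * ('chi_k 1%g * 'chi_l 1%g) * (x * y) =
  ('chi_k 1%g * x) * ('chi_l 1%g * y) + ('chi_l 1%g * x) * ('chi_k 1%g * y) by ring.
by apply: lerD; apply: ler_pM => //; apply: hD.
Qed.

(** Two characters, each squared, produce [z ^+ 4]. The sum over pairs then factors into two copies
    of the cycle generating function. *)
Lemma good_irr_product (z C : algC) (i j : Iirr (Wr n)) :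
  (forall j, D j -> forall a, `|'chi_j a| <= 'chi_j 1%g * z ^+ (n - #|porbits a|)) ->
  0 <= z -> (\prod_(k < n) (1 + k%:R * z ^+ 4)) ^+ 2 <= C ->
  good_irr i -> good_irr j ->
  \sum_(g in Wr n) `|'chi_i g * 'chi_j g| ^+ 2 <= C * ('chi_i 1%g * 'chi_j 1%g) ^+ 2.
Proof.
move=> hD z0 hC gi gj.
have -> : \sum_(g in Wr n) `|'chi_i g * 'chi_j g| ^+ 2
    = \sum_(g in base_group n) `|'chi_i g * 'chi_j g| ^+ 2.
  rewrite big_mkcond [RHS]big_mkcond; apply: eq_bigr => g _.
  have [Ng|nNg] := boolP (g \in base_group n).
    by rewrite (fintype.subsetP (base_group_sub n)).
  by rewrite good_irr_out // mul0r normr0 expr0n if_same.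
rewrite sum_base_group.
pose Z (a : {perm 'I_n}) := (z ^+ 4) ^+ (n - #|porbits a|).
apply: (@le_trans _ _ (\sum_(p : {perm 'I_n} * {perm 'I_n})
   ('chi_i 1%g * 'chi_j 1%g) ^+ 2 * (Z p.1 * Z p.2))).
  apply: ler_sum => p _; have bi := good_irr_bound p hD z0 gi.
  have bj := good_irr_bound p hD z0 gj.
  have -> : ('chi_i 1%g * 'chi_j 1%g) ^+ 2 * (Z p.1 * Z p.2) =
    (('chi_i 1%g * (z ^+ (n - #|porbits p.1|) * z ^+ (n - #|porbits p.2|)))
     * ('chi_j 1%g * (z ^+ (n - #|porbits p.1|) * z ^+ (n - #|porbits p.2|)))) ^+ 2.
    rewrite /Z; set r := (n - _)%N; set s := (n - _)%N.
    rewrite [(z ^+ 4) ^+ r]exprAC [(z ^+ 4) ^+ s]exprAC.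
    by move: (z ^+ r) (z ^+ s) ('chi_i 1%g) ('chi_j 1%g) => x y u v; ring.
  rewrite normrM; have le := ler_pM (normr_ge0 _) (normr_ge0 _) bi bj.
  by apply: lerXn2r le; rewrite nnegrE ?mulr_ge0 ?exprn_ge0 // ltW // irr1_gt0.
rewrite -mulr_sumr mulrC; apply: ler_wpM2r.
  by rewrite exprn_ge0 // mulr_ge0 // ltW // irr1_gt0.
have sZ : \sum_a Z a = \prod_(k < n) (1 + k%:R * z ^+ 4).
  by have := sum_porbits 'I_n (z ^+ 4); rewrite card_ord.
by apply: le_trans hC; rewrite expr2 -sZ big_distrlr pair_big.
Qed.

(** Odd powers of a flip exchange the sides, and even powers of an involution are trivial. *)
Lemma flip_cycle_base (m g : {perm 'I_(n + n)}) :
  flip m -> (m ^+ 2 = 1)%g -> g \in base_group n -> g \in <[m]>%g -> g = 1%g.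
Proof.
move=> fm m2 Ng /cycleP[k e]; subst g.
have sm : side_shift true m.
  by apply/forallP => i; rewrite addbT; apply: (forallP fm).
have sk : side_shift (odd k) (m ^+ k)%g.
  elim: (k) => [|q IH]; first by apply/forallP => i; rewrite perm1 addbF.
  by rewrite expgS oddS -addTb; apply: side_shiftM.
rewrite base_groupP in Ng; have ok := side_shift_uniq n_gt0 sk Ng.
by rewrite -(odd_double_half k) ok add0n -mul2n expgM m2 expg1n.
Qed.

(** The condition [C * eps0 <= eps ^+ 2] replaces the square root from Cauchy-Schwarz, so that [eps]
    can later be chosen rational. *)
Lemma accept_diff_wreath (z C eps0 eps : algC) (Alg : sieve_alg (Wr n))
    (m : {perm 'I_(n + n)}) :
  (forall j, D j -> forall a, `|'chi_j a| <= 'chi_j 1%g * z ^+ (n - #|porbits a|)) ->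
  0 <= z -> (\prod_(k < n) (1 + k%:R * z ^+ 4)) ^+ 2 <= C ->
  (\sum_(i : Iirr (SymG n)) 'chi_i 1%g ^+ 4) / (n`!)%:R ^+ 2
       + 2 * (\sum_(i : Iirr (SymG n) | ~~ D i) 'chi_i 1%g ^+ 2) / (n`!)%:R <= eps0 ->
  0 <= eps -> C * eps0 <= eps ^+ 2 ->
  flip m -> (m ^+ 2 = 1)%g ->
  `|accept_prob <[m]>%G Alg - accept_prob 1%G Alg| <= (ell Alg)%:R * (eps + eps0).
Proof.
move=> hD z0 hC h0 e0 he fm m2.
have hbad := le_trans bad_irr_weight h0.
have C0 : 0 <= C.
  apply: le_trans hC; rewrite exprn_ge0 // prodr_ge0 // => k _.
  by rewrite addr_ge0 ?mulr_ge0 ?ler0n ?exprn_ge0.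
apply: (@accept_diff _ _ (base_group n) _ good_irr) => //.
- exact: base_group_sub.
- by move=> g Ng; apply: flip_cycle_base.
- exact: good_irr_out.
move=> i j gi gj.
have dd : 0 <= 'chi_i 1%g * 'chi_j 1%g by rewrite mulr_ge0 ?ltW ?irr1_gt0.
have S0 : 0 <= \sum_(k | ~~ good_irr k) '['chi_i * 'chi_j, 'chi_k] * 'chi_k 1%g.
  apply: sumr_ge0 => k _; apply: mulr_ge0; last by rewrite ltW ?irr1_gt0.
  by apply: natr_ge0; rewrite Cnat_cfdot_char ?rpredM ?irr_char.
have E0 : 0 <= eps * ('chi_i 1%g * 'chi_j 1%g) by apply: mulr_ge0.
rewrite -(@ler_pXn2r _ 2) //.
apply: le_trans (bad_product_weight hbad C0 (good_irr_product hD z0 hC gi gj)) _.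
by rewrite [leRHS]exprMn; apply: ler_wpM2r => //; apply: exprn_ge0.
Qed.

End GoodIrreps.

(** * Real values and asymptotics *)

Lemma realC_le_rat (R : realType) (a : algC) (q : rat) :
  0 <= a -> a <= ratr q -> realC R a <= ratr q.
Proof.
move=> a0 aq; apply: ge_sup.
  by exists (ratr (-1)); exists (-1) => //=; rewrite rmorphN1 (lt_le_trans _ a0) // oppr_lt0.
move=> _ /= [r ra <-]; rewrite ler_rat -(ler_rat algC).
exact: le_trans (ltW ra) aq.
Qed.

(** A rational [q] below [a] belongs to the set whose supremum is [realC R a]; the strict inequality
    [y < ratr q] excludes this. *)
Lemma realC_lt_rat (R : realType) (a : algC) (y : R) (q : rat) :
  0 <= a -> realC R a <= y -> y < ratr q -> a <= ratr q.
Proof.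
move=> a0 ay yq; have ra := ger0_real a0.
have rq : (ratr q : algC) \is Num.real by rewrite realE ler0q lerq0 le_total.
rewrite real_leNgt //; apply/negP => qa.
have : ratr q <= realC R a.
  apply: ub_le_sup; last by exists q.
  exists (ratr (Num.bound a)%:R) => _ /= [r ra' <-]; rewrite ler_rat -(ler_rat algC).
  by rewrite ratr_nat (le_trans (ltW ra')) // ltW // archi_boundP.
by move=> h; have := le_lt_trans (le_trans h ay) yq; rewrite ltxx.
Qed.

Lemma realC_nat_le (R : realType) (k : nat) (y : R) : realC R k%:R <= y -> k%:R <= y.
Proof.
move=> ky; rewrite leNgt; apply/negP => yk.
have [q] := rat_in_itvoo yk; rewrite in_itv /= => /andP[yq qk].
have := realC_lt_rat (ler0n _ k) ky yq; rewrite -ratr_nat ler_rat => kq.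
by move: qk; rewrite -ratr_nat ltr_rat ltNge kq.
Qed.

(** The bound [(1 + K / n) ^ n <= e ^ K] holds in [R]; both sides of the claim are rational, so it
    transfers to [algC]. *)
Lemma ratr_exp_bound (R : realType) (K : nat) : exists C : nat, (0 < C)%N /\
  forall n, (0 < n)%N -> (1 + K%:R / n%:R) ^+ n <= C%:R :> algC.
Proof.
exists (Num.bound (expR K%:R : R)); split=> [|n n0].
  by rewrite -(ltr0n R) (lt_trans (expR_gt0 K%:R)) // archi_boundP // expR_ge0.
have -> : (1 + K%:R / n%:R) ^+ n = ratr ((1 + K%:R / n%:R) ^+ n) :> algC.
  by rewrite rmorphXn rmorphD rmorph1 fmorph_div /= !ratr_nat.
rewrite -[_%:R in leRHS]ratr_nat ler_rat -(ler_rat R) ratr_nat.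
rewrite rmorphXn rmorphD rmorph1 fmorph_div /= !ratr_nat.
apply: le_trans (ltW (archi_boundP (expR_ge0 _))).
have N0 : n%:R != 0 :> R by rewrite pnatr_eq0 -lt0n.
have -> : expR K%:R = expR (K%:R / n%:R) ^+ n :> R.
  by rewrite -expRM_natl; congr expR; field.
by rewrite lerXn2r ?nnegrE ?expR_ge0 ?addr_ge0 ?divr_ge0 // expR_ge1Dx.
Qed.

Lemma floor_sqrt (n : nat) : exists s : nat, (s ^ 2 <= n < s.+1 ^ 2)%N.
Proof.
elim: n => [|n [s /andP[h1 h2]]]; first by exists 0%N.
have [lt|ge] := ltnP n.+1 (s.+1 ^ 2).
  by exists s; rewrite lt (leq_trans h1).
by exists s.+1; rewrite ge (leq_ltn_trans h2) // ltn_exp2r.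
Qed.

(** In the induction, [ln (1 - 1 / (n + 2)) <= - 1 / (n + 2)] bounds the new term by the increment
    of the logarithm. *)
Lemma harmonic_le (R : realType) (n : nat) : (0 < n)%N ->
  \sum_(i < n) i.+1%:R^-1 <= 1 + ln n%:R :> R.
Proof.
case: n => // n _; elim: n => [|n IH]; first by rewrite big_ord1 invr1 ln1 addr0.
rewrite big_ord_recr /=; apply: le_trans (lerD IH (lexx _)) _.
rewrite -addrA lerD2l -lerBrDl -ln_div ?posrE //.
have p2 : (0 : R) < n.+2%:R by [].
have p1 : (0 : R) < n.+1%:R by [].
rewrite -lerN2 -lnV ?posrE ?divr_gt0 // invf_div.
have -> : n.+1%:R / n.+2%:R = 1 + - n.+2%:R^-1 :> R.
  apply: (mulIf (lt0r_neq0 p2)); rewrite mulrDl mulNr mulVf ?divfK ?lt0r_neq0 //.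
  by rewrite mul1r -(natr1 n.+1) addrK.
apply: le_ln1Dx; rewrite ltrN2 invf_lt1 // ltr1n //.
Qed.

(** Take [x = e ^ (- 1 / w)] in the Euler product, with [w] the square root of [n]. Then
    [x ^+ n = e ^ (- w)], and the factor of index [i] is at most [1 + w / (i + 1)], hence at most
    [e ^ (w / (i + 1))]; the harmonic sum gives the logarithm. *)
Lemma Nirr_Sym_exp (R : realType) (n : nat) : (0 < n)%N ->
  (Nirr (SymG n))%:R <= expR (2 * Num.sqrt n%:R + Num.sqrt n%:R * ln n%:R) :> R.
Proof.
move=> n0; set w : R := Num.sqrt n%:R.
have w0 : 0 < w by rewrite sqrtr_gt0 ltr0n.
have ww : n%:R = w * w by rewrite -expr2 sqr_sqrtr ?ler0n.
pose x : R := expR (- w^-1).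
have x01 : 0 < x < 1 by rewrite expR_gt0 expR_lt1 oppr_lt0 invr_gt0.
have := Nirr_Sym_gen n x01.
have -> : x ^+ n = (expR w)^-1.
  rewrite /x -expRM_natl -expRN ww; congr expR; field; exact: lt0r_neq0.
rewrite ler_pdivrMr ?expR_gt0 // => h; apply: le_trans h _.
have -> : 2 * w + w * ln n%:R = w * (1 + ln n%:R) + w by ring.
rewrite expRD ler_wpM2r ?expR_ge0 //.
apply: (@le_trans _ _ (expR (w * \sum_(i < n) i.+1%:R^-1))); last first.
  by rewrite ler_expR ler_pM2l // harmonic_le.
rewrite mulr_sumr expR_sum; apply: ler_prod => i _.
pose y : R := i.+1%:R / w.
have y0 : 0 < y by rewrite divr_gt0.
have -> : x ^+ i.+1 = expR (- y) by rewrite /x -expRM_natl; congr expR; rewrite /y mulrN.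
have ey : 1 < expR y by rewrite expR_gt1.
have d0 : 0 < 1 - expR (- y) by rewrite subr_gt0 expR_lt1 oppr_lt0.
rewrite invr_ge0 (ltW d0) /=.
have -> : w / i.+1%:R = y^-1 by rewrite /y invf_div.
have -> : (1 - expR (- y))^-1 = 1 + (expR y - 1)^-1.
  rewrite expRN; field; rewrite (lt0r_neq0 (expR_gt0 y)) subr_eq0.
  by rewrite (gt_eqF ey).
apply: le_trans (expR_ge1Dx _); rewrite lerD2l lef_pV2 ?posrE ?subr_gt0 //.
by rewrite lerBrDl expR_ge1Dx.
Qed.

Lemma nat_le_sqrt (R : realType) (s n : nat) :
  (s ^ 2 <= n)%N -> s%:R <= Num.sqrt n%:R :> R.
Proof.
move=> sn; rewrite -[leLHS](ger0_norm (ler0n _ _)) -sqrtr_sqr ler_wsqrtr //.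
by rewrite -natrX ler_nat.
Qed.

(* With [s] the integer part of [sqrt n], the rational [B / s] replaces [A / sqrt n],
   so that the bound can be stated in [algC]. *)
Lemma irr_ratio_bound (R : realType) (n B s : nat) (A : R) (j : Iirr (SymG n)) :
  (0 < s)%N -> (s ^ 2 <= n)%N -> (B <= s)%N -> `|A| < B%:R ->
  (forall a : {perm 'I_n}, realC R `|'chi_j a / 'chi_j 1%g|
     <= A ^+ tcount a / Num.sqrt n%:R ^+ tcount a) ->
  forall a, `|'chi_j a| <= 'chi_j 1%g * (B%:R / s%:R) ^+ (n - #|porbits a|).
Proof.
move=> s0 sn Bs AB h a.
have d0 : 0 < 'chi_j 1%g by apply: irr1_gt0.
have z0 : 0 <= B%:R / s%:R :> algC by rewrite divr_ge0 ?ler0n.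
have z1 : B%:R / s%:R <= 1 :> algC by rewrite ler_pdivrMr ?ltr0n // mul1r ler_nat.
have eq : `|'chi_j a| = 'chi_j 1%g * `|'chi_j a / 'chi_j 1%g|.
  by rewrite normf_div (ger0_norm (ltW d0)) mulrC divfK ?lt0r_neq0.
rewrite eq ler_pM2l //.
have tle : (n - #|porbits a| <= tcount a)%N by rewrite leq_subLR addnC tcount_ge.
apply: le_trans (ler_wiXn2l z0 z1 tle).
(* Exponent 0 is treated apart: the strict comparison of powers used below fails there, while the
   ratio is at most 1 anyway. *)
have [t0|t0] := posnP (tcount a).
  rewrite t0 expr0 normf_div (ger0_norm (ltW d0)) ler_pdivrMr // mul1r.
  exact/char1_ge_norm/irr_char.
have -> : (B%:R / s%:R) ^+ tcount a = ratr ((B%:R / s%:R) ^+ tcount a) :> algC.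
  by rewrite rmorphXn fmorph_div /= !ratr_nat.
apply: (realC_lt_rat (R := R)) (h a) _ => //.
have s0R : (0 : R) < s%:R by rewrite ltr0n.
have sw := nat_le_sqrt R sn.
have w0 := lt_le_trans s0R sw.
rewrite rmorphXn fmorph_div /= !ratr_nat -expr_div_n.
apply: le_lt_trans (ler_norm _) _; rewrite normrX.
rewrite ltrXn2r -?lt0n // normf_div (gtr0_norm w0).
rewrite ltr_pdivrMr // mulrAC ltr_pdivlMr //.
apply: (@le_lt_trans _ _ (`|A| * Num.sqrt n%:R)); first by rewrite ler_wpM2l.
by rewrite ltr_pM2r.
Qed.

(** The first term uses [d ^ 4 <= e ^ (- chat w) n! d ^ 2] and [sum d ^ 2 = n!]. In the second, at
    most [e ^ (w (2 + ln n))] irreducibles each weigh at most [e ^ (- 2 w ln n)], and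
    [chat + 2 <= ln n] absorbs the excess. Degrees are integers, so the value is rational and can be
    read in both fields. *)
Lemma small_plancherel (R : realType) (chat : R) (n : nat) (D : pred (Iirr (SymG n))) :
  (0 < n)%N -> chat + 2 <= ln n%:R ->
  (forall i : Iirr (SymG n), realC R ('chi_i 1%g)
       <= expR (- (chat / 2) * Num.sqrt n%:R) * Num.sqrt (n`!)%:R) ->
  (forall i : Iirr (SymG n), ~~ D i -> realC R ('chi_i 1%g)
       <= expR (- (Num.sqrt n%:R * ln n%:R)) * Num.sqrt (n`!)%:R) ->
  exists2 q : rat,
    (\sum_(i : Iirr (SymG n)) 'chi_i 1%g ^+ 4) / (n`!)%:R ^+ 2
       + 2 * (\sum_(i : Iirr (SymG n) | ~~ D i) 'chi_i 1%g ^+ 2) / (n`!)%:R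
      = ratr q :> algC
    & ratr q <= 3 * expR (- (chat * Num.sqrt n%:R)) :> R.
Proof.
move=> n0 lnn h1 h2; set w := Num.sqrt n%:R in h1 h2 *.
pose dg (i : Iirr (SymG n)) := irr_degree (socle_of_Iirr i).
have dgE i : 'chi_i 1%g = (dg i)%:R by apply: irr1_degree.
exists ((\sum_i (dg i)%:R ^+ 4) / (n`!)%:R ^+ 2
   + 2 * (\sum_(i | ~~ D i) (dg i)%:R ^+ 2) / (n`!)%:R).
  rewrite rmorphD !fmorph_div /= [ratr (2 * _)]rmorphM [ratr (_%:R ^+ 2)]rmorphXn /= !rmorph_sum /= !ratr_nat.
  congr (_ / _ + _ * _ / _); apply: eq_bigr => i _;
    by rewrite dgE rmorphXn /= ratr_nat.
rewrite rmorphD !fmorph_div /= [ratr (2 * _)]rmorphM [ratr (_%:R ^+ 2)]rmorphXn /= !rmorph_sum /= !ratr_nat.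
under eq_bigr => i _ do rewrite rmorphXn /= ratr_nat.
under [X in 2 * X]eq_bigr => i _ do rewrite rmorphXn /= ratr_nat.
have F0 : 0 < (n`!)%:R :> R by rewrite ltr0n fact_gt0.
have sq (x : R) i : (dg i)%:R <= expR x * Num.sqrt (n`!)%:R ->
    (dg i)%:R ^+ 2 <= expR (2 * x) * (n`!)%:R.
  move=> le; have : (dg i)%:R ^+ 2 <= (expR x * Num.sqrt (n`!)%:R) ^+ 2.
    by rewrite lerXn2r ?nnegrE ?mulr_ge0 ?expR_ge0 ?sqrtr_ge0.
  by rewrite exprMn sqr_sqrtr ?(ltW F0) // -expRM_natl.
have tot : \sum_i (dg i)%:R ^+ 2 = (n`!)%:R :> R.
  have := irr_sum_square (SymG n); rewrite card_SymG.
  under eq_bigr => i _ do rewrite dgE -natrX.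
  rewrite -natr_sum => /eqP; rewrite eqr_nat => /eqP <-.
  by rewrite natr_sum; apply: eq_bigr => i _; rewrite natrX.
have b1 : (\sum_i (dg i)%:R ^+ 4) / (n`!)%:R ^+ 2 <= expR (- (chat * w)) :> R.
  rewrite ler_pdivrMr ?exprn_gt0 // expr2 mulrA -{2}tot mulr_sumr.
  apply: ler_sum => i _; rewrite (exprM _ 2 2) [X in X <= _]expr2 ler_wpM2r ?exprn_ge0 //.
  have -> : - (chat * w) = 2 * (- (chat / 2) * w) by field.
  by apply: sq; apply: realC_nat_le; rewrite -dgE.
have b2 : (\sum_(i | ~~ D i) (dg i)%:R ^+ 2) / (n`!)%:R <= expR (- (chat * w)) :> R.
  rewrite ler_pdivrMr //.
  apply: (@le_trans _ _ (\sum_(i : Iirr (SymG n) | ~~ D i) expR (2 * - (w * ln n%:R)) * (n`!)%:R)).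
    by apply: ler_sum => i Di; apply: sq; apply: realC_nat_le; rewrite -dgE; apply: h2.
  rewrite -mulr_suml ler_wpM2r ?(ltW F0) //.
  apply: (@le_trans _ _ (\sum_(i : Iirr (SymG n)) expR (2 * - (w * ln n%:R)))).
    rewrite [leRHS](bigID D) /= lerDr; apply: sumr_ge0 => i _; exact: expR_ge0.
  rewrite sumr_const card_ord -[(_ *+ _)]mulr_natl.
  apply: le_trans (ler_wpM2r (expR_ge0 _) (Nirr_Sym_exp R n0)) _.
  rewrite -expRD ler_expR -/w.
  have w0 : 0 <= w by apply: sqrtr_ge0.
  by have := ler_wpM2l w0 lnn; lra.
rewrite -mulrA; lra.
Qed.

(** * Choice of the constants and final estimate *)

Theorem theorem2 (R : realType) (chat : R) :
  0 < chat ->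
  (forall n : nat, (2 <= n)%N -> forall i : Iirr (SymG n),
     realC R ('chi[SymG n]_i 1%g)
       <= expR (- (chat / 2) * Num.sqrt (n%:R)) * Num.sqrt ((n`!)%:R)) ->
  (exists A : R, exists N : nat, forall n : nat, (N <= n)%N ->
     forall i : Iirr (SymG n),
       expR (- (Num.sqrt (n%:R) * ln (n%:R))) * Num.sqrt ((n`!)%:R)
         < realC R ('chi[SymG n]_i 1%g) ->
       forall pi : {perm 'I_n},
         realC R `|'chi[SymG n]_i pi / 'chi[SymG n]_i 1%g|
           <= A ^+ tcount pi / Num.sqrt (n%:R) ^+ tcount pi) ->
  forall b c : R, b < chat / 2 -> c < chat / 2 - b ->
  exists N : nat, forall n : nat, (N <= n)%N ->
    forall Alg : sieve_alg (Wr n),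
      (ell Alg)%:R < expR (b * Num.sqrt (n%:R)) ->
      forall m : {perm 'I_(n + n)},
        m \in Wr n -> flip m -> (m ^+ 2 = 1)%g ->
        realC R `|accept_prob (<[m]>%G) Alg - accept_prob 1%G Alg|
          <= expR (- c * Num.sqrt (n%:R)).
Proof.
move=> chat0 hdim [A [N1 hchar]] b c hb hc.
(* The constant 16 comes from [n <= 4 s ^ 2] for the integer square root [s] of [n]: then
   [k / s ^ 4 <= 16 / n] for all [k < n]. *)
have [C [C0 hC]] : exists C : nat, (0 < C)%N /\ forall n, (0 < n)%N ->
    (1 + (16 * (Num.bound `|A|) ^ 4)%N%:R / n%:R) ^+ n <= C%:R :> algC.
  exact: ratr_exp_bound R _.
set B := Num.bound `|A| in hC.
have AB : `|A| < B%:R by apply: archi_boundP.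
pose dl := chat / 2 - b - c.
have dl0 : 0 < dl by rewrite /dl; lra.
pose C2 : R := C%:R ^+ 2.
have C21 : 1 <= C2 by rewrite /C2 exprn_ege1 // ler1n.
pose N2 := Num.bound (expR (chat + 2)); pose N3 := Num.bound (9 * C2 / dl).
(* The bound 2 is for [hdim], [N1] for [hchar], [B.+1 ^ 2] for [B <= s], [N2] for
   [chat + 2 <= ln n], and [N3 ^ 2] for [9 * C2 <= dl * w]. *)
exists (maxn 2 (maxn N1 (maxn (B.+1 ^ 2) (maxn N2 (N3 ^ 2)))))%N => n.
rewrite !geq_max => /and5P[n2 nN1 nB nN2 nN3] Alg hell m mW fm m2.
have n0 := ltnW n2.
set w := Num.sqrt n%:R in hell *.
have w0 : 0 < w by rewrite sqrtr_gt0 ltr0n.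
have lnn : chat + 2 <= ln n%:R.
  rewrite -ler_expR lnK ?posrE ?ltr0n //.
  apply: le_trans (ltW (archi_boundP (expR_ge0 _))) _; by rewrite ler_nat.
have wN3 : 9 * C2 / dl <= w.
  apply: (@le_trans _ _ N3%:R).
    by apply/ltW/archi_boundP; rewrite divr_ge0 ?(ltW dl0) // mulr_ge0 // (le_trans _ C21).
  exact: nat_le_sqrt.
have [s /andP[sn ns]] := floor_sqrt n.
have Bs : (B <= s)%N.
  have : (B.+1 ^ 2 < s.+1 ^ 2)%N by apply: leq_ltn_trans ns.
  by rewrite ltn_exp2r // ltnS => /ltnW.
have s0 : (0 < s)%N.
  by rewrite lt0n; apply: contraTneq ns => ->; rewrite -leqNgt exp1n.
pose thr : R := expR (- (w * ln n%:R)) * Num.sqrt (n`!)%:R.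
pose D (i : Iirr (SymG n)) : bool := thr < realC R ('chi_i 1%g).
have hD i : D i -> forall a, `|'chi_i a| <= 'chi_i 1%g * (B%:R / s%:R) ^+ (n - #|porbits a|).
  move=> Di; apply: (irr_ratio_bound (A := A)) => // a.
  exact: hchar Di a.
have [q0 q0E q0le] : exists2 q : rat,
    (\sum_(i : Iirr (SymG n)) 'chi_i 1%g ^+ 4) / (n`!)%:R ^+ 2
       + 2 * (\sum_(i : Iirr (SymG n) | ~~ D i) 'chi_i 1%g ^+ 2) / (n`!)%:R
      = ratr q :> algC
    & ratr q <= 3 * expR (- (chat * w)) :> R.
  apply: small_plancherel => //; first exact: hdim.
  by move=> i; rewrite /D -leNgt.
have z0 : 0 <= B%:R / s%:R :> algC by rewrite divr_ge0 ?ler0n.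
have hprod : (\prod_(k < n) (1 + k%:R * (B%:R / s%:R) ^+ 4)) ^+ 2 <= C%:R ^+ 2 :> algC.
  rewrite lerXn2r ?nnegrE ?ler0n //.
    by apply: prodr_ge0 => k _; rewrite addr_ge0 ?mulr_ge0 ?exprn_ge0.
  apply: le_trans (hC n n0).
  rewrite -[n in leRHS]card_ord -prodr_const; apply: ler_prod => k _.
  rewrite addr_ge0 ?mulr_ge0 ?exprn_ge0 //= lerD2l.
  have s0C : 0 < s%:R :> algC by rewrite ltr0n.
  have n0C : 0 < n%:R :> algC by rewrite ltr0n.
  rewrite card_ord expr_div_n mulrA ler_pdivrMr ?exprn_gt0 // mulrAC ler_pdivlMr //.
  rewrite -!natrX -!natrM ler_nat.
  have hk : (k <= n)%N by apply: ltnW.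
  have hs : (n <= 4 * s ^ 2)%N.
    apply: ltnW; apply: leq_trans ns _; rewrite -[4%N]/(2 ^ 2)%N -expnMn leq_exp2r //.
    by rewrite mul2n -addnn -addn1 leq_add2l.
  have hn : (k * n <= 16 * s ^ 4)%N.
    have -> : (16 * s ^ 4 = (4 * s ^ 2) * (4 * s ^ 2))%N by rewrite mulnACA -expnD.
    by rewrite leq_mul // (leq_trans hk).
  by rewrite mulnAC [leqRHS]mulnAC leq_mul2r hn orbT.
(* As [C2 * 3 * e ^ 2 <= y ^ 2] for [e] the exponential below, any rational between [y] and [2 * y]
   can serve as [eps]. *)
pose y : R := 3 * C2 * expR (- (chat / 2) * w).
have y0 : 0 < y by rewrite mulr_gt0 ?expR_gt0 // mulr_gt0 // (lt_le_trans _ C21).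
have [q] : exists q : rat, ratr q \in `]y, (2 * y)[.
  by apply: rat_in_itvoo; lra.
rewrite in_itv /= => /andP[yq q2y].
have q_ge0 : 0 <= q by rewrite -(ler0q R) (le_trans (ltW y0)) // ltW.
have ee : expR (- (chat * w)) = expR (- (chat / 2) * w) ^+ 2 :> R.
  by rewrite -expRM_natl; congr expR; field.
have e1 : expR (- (chat / 2) * w) <= 1.
  by rewrite -expR0 ler_expR mulNr oppr_le0 mulr_ge0 ?(ltW w0) // divr_ge0 // ltW.
set e := expR (- (chat / 2) * w) in y ee e1 y0 yq q2y.
have e0 : 0 < e by apply: expR_gt0.
have heps : C%:R ^+ 2 * ratr q0 <= (ratr q : algC) ^+ 2.
  rewrite -(ratr_nat _ C) -!rmorphXn -rmorphM /= ler_rat -(ler_rat R).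
  rewrite rmorphM !rmorphXn /= ratr_nat -/C2.
  apply: (@le_trans _ _ (y ^+ 2)); last by rewrite lerXn2r ?nnegrE ?ler0q ?(ltW y0) // ltW.
  apply: (@le_trans _ _ (C2 * (3 * e ^+ 2))).
    by rewrite ler_wpM2l ?(le_trans _ C21) // -ee.
  have -> : y ^+ 2 = C2 * (9 * C2 * e ^+ 2) by rewrite /y; ring.
  rewrite ler_wpM2l ?(le_trans _ C21) // ler_wpM2r ?exprn_ge0 ?(ltW e0) //; lra.
have main : `|accept_prob <[m]>%G Alg - accept_prob 1%G Alg|
    <= (ell Alg)%:R * (ratr q + ratr q0).
  by apply: (accept_diff_wreath n0 Alg hD z0 hprod _ _ heps fm m2); rewrite ?q0E ?ler0q.
apply: (@le_trans _ _ (ratr ((ell Alg)%:R * (q + q0)))).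
  by apply: realC_le_rat => //; rewrite rmorphM rmorphD /= ratr_nat.
rewrite rmorphM rmorphD /= ratr_nat.
have q09 : ratr q + ratr q0 <= 9 * C2 * e.
  have : ratr q0 <= 3 * e.
    by apply: le_trans q0le _; rewrite ee ler_wpM2l // expr2 ler_piMr // ltW.
  have : ratr q <= 6 * C2 * e by apply: le_trans (ltW q2y) _; rewrite /y; lra.
  have : e <= C2 * e by rewrite ler_peMl // ltW.
  lra.
have qq : 0 <= ratr q + ratr q0 :> R.
  rewrite -rmorphD ler0q -(ler0q algC) rmorphD /= -q0E addr_ge0 ?ler0q //.
  have d0 (i : Iirr (SymG n)) k : 0 <= 'chi_i 1%g ^+ k.
    by rewrite exprn_ge0 // ltW // irr1_gt0.
  by rewrite addr_ge0 ?divr_ge0 ?mulr_ge0 ?exprn_ge0 ?ler0n ?sumr_ge0.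
apply: (@le_trans _ _ (expR (b * w) * (9 * C2 * e))).
  by apply: ler_pM => //; apply: ltW.
(* The slack [dl] in the exponent absorbs the constant, leaving [b + dl - chat / 2 = - c]. *)
have : 9 * C2 <= expR (dl * w).
  apply: le_trans (expR_ge1Dx _); rewrite addrC -[9 * C2](divfK (lt0r_neq0 dl0)).
  by rewrite mulrC (le_trans (ler_wpM2l (ltW dl0) wN3)) // lerDl.
move=> h9; have -> : expR (b * w) * (9 * C2 * e) = 9 * C2 * (expR (b * w) * e) by ring.
apply: le_trans (ler_wpM2r _ h9) _; first by rewrite mulr_ge0 ?expR_ge0 ?(ltW e0).
rewrite /e -!expRD ler_expR /dl; lra.
Qed.
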